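(* Let $m$, $n$ and $d$ be positive integers with $m<d$, and let $b$ be a real number with $b\notin \mathbb{Z}/d$. Put $t_1=e^{-2\pi i mb}$, $t_2=e^{-2\pi i db}$, $t_1'=e^{2\pi i mb}$ and $t_2'=e^{2\pi i db}$. Then $$\sum_{j=1}^{d-1} \sin\Big(\frac{2\pi mj}{d}\Big)\csc^{2n}\Big(\frac{\pi j}{d}+\pi b\Big) = -\sum i^{\mu+\nu}\,2^{\mu+\nu}\,\frac{m^\mu}{\mu!}\,\frac{d^{\nu+1}}{\nu!}\Big(t_1 A_\nu(t_2)+(-1)^{\mu+\nu}t_1' A_\nu(t_2')\Big)F(j_1,\ldots,j_{2n}),$$ where the sum on the right is over all nonnegative integers $j_1,\ldots,j_{2n},\mu,\nu$ such that $2j_1+\cdots+2j_{2n}+\mu+\nu=2n-1$ (so that $\mu+\nu$ is odd).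
   Context: Here $i$ is the imaginary unit, $\csc$ denotes the cosecant, and $\mathbb{Z}/d=\{k/d : k\in\mathbb{Z}\}$. For a complex number $t\neq 1$, the numbers $A_\nu(t)$, $\nu\ge 0$, are defined by the power series expansion about $z=0$: $\frac{1}{te^z-1}=\sum_{\nu=0}^{\infty}\frac{A_\nu(t)}{\nu!}z^\nu$ (e.g. $A_0(t)=\frac{1}{t-1}$, $A_1(t)=\frac{-t}{(t-1)^2}$). For $j\ge 0$, $G_j=\frac{(-1)^j\,2(2^{2j-1}-1)B_{2j}}{(2j)!}$, where $B_k$ are the Bernoulli numbers ($\frac{x}{e^x-1}=\sum_{k\ge 0}B_k\frac{x^k}{k!}$); thus $G_0=-1$, $G_1=-\frac16$, $G_2=-\frac{7}{360}$, and these are the coefficients in $-\csc(\pi w)=\sum_{j\ge 0}G_j\pi^{2j-1}w^{2j-1}$ near $w=0$. Finally $F(j_1,\ldots,j_{N})=\prod_{r=1}^{N}G_{j_r}$. *)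

(* Defs.v *)
From HB Require Import structures.
From mathcomp Require Import all_boot all_order all_algebra.
From mathcomp Require Import complex.
From mathcomp Require Import all_classical all_reals all_analysis.

Set Implicit Arguments.
Unset Strict Implicit.
Unset Printing Implicit Defensive.

Import Order.TTheory GRing.Theory Num.Theory.
Import numFieldNormedType.Exports.

Local Open Scope classical_set_scope.
Local Open Scope complex_scope.
Local Open Scope ring_scope.

(* In the library the norm topology comes with an abstract numFieldType; the
   next three definitions are stated over such a field so that they can be
   instantiated at the complex numbers R[i] (and [egf_sum] also at R). *)

(* The series \sum_k a_k z^k / k! converges to s. *)
Definition egf_sum (K : numFieldType) (a : nat -> K) (z s : K) : Prop :=
  series (fun k => a k / k`!%:R * z ^+ k) @ \oo --> s.

(* Same definition as the library's real [expR]. *)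
Definition cexp (K : numFieldType) (z : K) : K :=
  limn (series (fun k => z ^+ k / k`!%:R)).

(* Only meaningful for t != 1. *)
Definition A (K : numFieldType) (t : K) : nat -> K :=
  get [set a : nat -> K |
       \forall z \near (0 : K), egf_sum a z (t * cexp z - 1)^-1].

Definition csc (R : realType) (x : R) : R := (sin x)^-1.

(* The neighbourhood of 0 is punctured since x / (e^x - 1) is 0 / 0 at x = 0. *)
Definition bernoulli (R : realType) : nat -> R :=
  get [set B : nat -> R |
       \forall x \near (0 : R)^', egf_sum B x (x / (expR x - 1))].

(* The exponent 2 j - 1 is an integer, equal to -1 when j = 0. *)
Definition G (R : realType) (j : nat) : R :=
  (- 1) ^+ j * 2 * ((2 : R) ^ (2 * j%:Z - 1) - 1) * bernoulli R (2 * j)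
  / (2 * j)`!%:R.

Definition F (R : realType) (N : nat) (j : 'I_N -> nat) : R :=
  \prod_(r < N) G R (j r).

(* Main.v *)
Require Import Defs.
From HB Require Import structures.
From mathcomp Require Import all_boot all_order all_algebra.
From mathcomp Require Import complex.
From mathcomp Require Import all_classical all_reals all_analysis.
From mathcomp Require Import ring zify.

Set Implicit Arguments.
Unset Strict Implicit.
Unset Printing Implicit Defensive.

Import Order.TTheory GRing.Theory Num.Theory.
Import numFieldNormedType.Exports.

Local Open Scope complex_scope.
Local Open Scope ring_scope.

(** The right-hand side is a coefficient of a product of power series. The
    numbers [G R j] are the coefficients of [- z / sin z], and the numbers
    [A t nu] those of [1 / (t exp z - 1)] as an exponential series. Put
    [W = (z / sin z) ^ 2]. Expanding products, the right-hand side is minus the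
    coefficient of [z ^ (2n - 1)] in
      [W ^ n (d t1 e^(2imz) / (t2 e^(2idz) - 1)
              + d t1' e^(-2imz) / (t2' e^(-2idz) - 1))].
    In other words it is minus the residue at [0] of the bracket divided by
    [sin z ^ 2n] ([coef_product], [one_sided_sum]).

    Write [v = e^(cz)] with [c = 2i] or [c = -2i], and let [w] run over the [d]
    roots of [w ^ d = T], where [T] is the inverse of [t2] or of [t2']. The
    power sums of these roots vanish in degrees not divisible by [d], which
    gives the partial fraction expansion ([sum_resolvent])
      [d v^m / (T^-1 v^d - 1) = - sum_w w^m v / (w - v)].
    Everything is reduced to one residue ([coef_residue]): the coefficient of
    [z ^ (2n - 1)] in [W ^ n v / (w - v)] is [kappa w ^ n / c], where
    [kappa w = - 4 w / (w - 1) ^ 2] is [csc theta ^ 2] for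
    [w = e^(2 i theta)]. For [w = e^(2 i (pi j / d + pi b))] the two halves of
    the bracket carry the factors [e^(2 i pi m j / d)] and its inverse with
    opposite signs, and they combine into the sine of the left-hand side.

    The residue could be moved to the pole at [theta] by a contour. Here it is
    computed by induction on [n], inside formal power series. Since
    [W = z ^ 2 kappa v], it suffices to note that [kappa v - kappa w] is
    divisible by [w - v]: the product of [v / (w - v)] with this difference has
    no pole at [v = w], and what is left consists of even functions and of
    derivatives, which have no residue. The only exception is [n = 1], where a
    term [1 / z] starts the induction.

    [A] and [bernoulli] are only known through the sums of convergent series.
    Two facts link them to formal inverses: the formal inverse of a series with
    bounded coefficients converges near [0] to the inverse of its sum
    ([inverse_sums_to]), and a power series is determined by its sums near [0]
    ([fps_eq_near]). *)

(** * Formal power series *)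

(** A record, so that the ring product is the Cauchy product and not the
    pointwise product of functions. *)
Record fps (K : Type) := Fps { fcoef : nat -> K }.
Coercion fcoef : fps >-> Funclass.

Lemma fpsP (K : Type) (f g : fps K) : f =1 g -> f = g.
Proof. by case: f g => [f] [g] /= /funext ->. Qed.

HB.instance Definition _ (K : Type) := gen_eqMixin (fps K).
HB.instance Definition _ (K : Type) := gen_choiceMixin (fps K).

Section FpsRing.
Variable K : comNzRingType.
Implicit Types f g h : fps K.

Definition fps_zero : fps K := Fps (fun=> 0).
Definition fps_opp f := Fps (fun k => - f k).
Definition fps_add f g := Fps (fun k => f k + g k).

Fact fps_addA : associative fps_add.
Proof. by move=> f g h; apply: fpsP => k /=; rewrite addrA. Qed.
Fact fps_addC : commutative fps_add.
Proof. by move=> f g; apply: fpsP => k /=; rewrite addrC. Qed.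
Fact fps_add0 : left_id fps_zero fps_add.
Proof. by move=> f; apply: fpsP => k /=; rewrite add0r. Qed.
Fact fps_addN : left_inverse fps_zero fps_opp fps_add.
Proof. by move=> f; apply: fpsP => k /=; rewrite addNr. Qed.

HB.instance Definition _ :=
  GRing.isZmodule.Build (fps K) fps_addA fps_addC fps_add0 fps_addN.

Definition fpsC (a : K) : fps K := Fps (fun k => if k is 0 then a else 0).
Definition fps_mul f g := Fps (fun k => \sum_(i < k.+1) f i * g (k - i)%N).

(** Coefficients below degree [N] of a product only depend on truncations, so
    the ring axioms are inherited from polynomials. *)
Definition ftrunc N f : {poly K} := \poly_(i < N) f i.

Lemma coef_ftrunc N f k : (k < N)%N -> (ftrunc N f)`_k = f k.
Proof. by rewrite coef_poly => ->. Qed.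

Lemma ftrunc_mul N f g k : (k < N)%N ->
  (ftrunc N f * ftrunc N g)`_k = fps_mul f g k.
Proof.
move=> kN; rewrite coefM; apply: eq_bigr => i _.
by have ik := ltn_ord i; rewrite !coef_ftrunc //; lia.
Qed.

Fact fps_mulC : commutative fps_mul.
Proof.
by move=> f g; apply: fpsP => k; rewrite -!(@ftrunc_mul k.+1) // mulrC.
Qed.
Fact fps_mulA : associative fps_mul.
Proof.
move=> f g h; apply: fpsP => k.
transitivity ((ftrunc k.+1 f * ftrunc k.+1 g * ftrunc k.+1 h)`_k).
  rewrite -mulrA coefM; apply: eq_bigr => i _.
  by have ik := ltn_ord i; rewrite coef_ftrunc // ftrunc_mul //; lia.
rewrite coefM; apply: eq_bigr => i _.
by have ik := ltn_ord i; rewrite coef_ftrunc ?ftrunc_mul //; lia.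
Qed.
Fact fps_mul1 : left_id (fpsC 1) fps_mul.
Proof.
move=> f; apply: fpsP => k /=.
by rewrite big_ord_recl /= mul1r subn0 big1 ?addr0 // => i _; rewrite mul0r.
Qed.
Fact fps_mulD : left_distributive fps_mul fps_add.
Proof.
move=> f g h; apply: fpsP => k /=.
by rewrite -big_split; apply: eq_bigr => i _; rewrite mulrDl.
Qed.
Fact fps_1neq0 : fpsC 1 != 0.
Proof.
by apply/eqP => /(congr1 (fun f : fps K => f 0%N))/eqP; rewrite /= oner_eq0.
Qed.

HB.instance Definition _ := GRing.Zmodule_isComNzRing.Build (fps K)
  fps_mulA fps_mulC fps_mul1 fps_mulD fps_1neq0.

Lemma fpsE0 k : (0 : fps K) k = 0. Proof. by []. Qed.
Lemma fpsE1 k : (1 : fps K) k = (k == 0)%:R. Proof. by case: k. Qed.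
Lemma fpsED f g k : (f + g) k = f k + g k. Proof. by []. Qed.
Lemma fpsEN f k : (- f) k = - f k. Proof. by []. Qed.
Lemma fpsEB f g k : (f - g) k = f k - g k. Proof. by []. Qed.
Lemma fpsEM f g k : (f * g) k = \sum_(i < k.+1) f i * g (k - i)%N.
Proof. by []. Qed.
Lemma fpsE_sum I (r : seq I) (P : pred I) (H : I -> fps K) k :
  (\sum_(i <- r | P i) H i) k = \sum_(i <- r | P i) H i k.
Proof. by elim/big_rec2: _ => // i x y _ <-. Qed.

Lemma fpsE_M0 f g : (f * g) 0%N = f 0%N * g 0%N.
Proof. by rewrite fpsEM big_ord1 subn0. Qed.

Lemma coef_ftruncM N f g k : (k < N)%N ->
  (ftrunc N f * ftrunc N g)`_k = (f * g) k.
Proof. exact: ftrunc_mul. Qed.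

Definition agree N (p : {poly K}) f := forall k, (k < N)%N -> p`_k = f k.

Lemma agree_ftrunc N f : agree N (ftrunc N f) f.
Proof. by move=> k; apply: coef_ftrunc. Qed.

Lemma agreeM N p q f g : agree N p f -> agree N q g -> agree N (p * q) (f * g).
Proof.
move=> pf qg k kN; rewrite coefM fpsEM; apply: eq_bigr => i _.
by have ik := ltn_ord i; rewrite pf ?qg //; lia.
Qed.

Lemma agreeX N p f n : agree N p f -> agree N (p ^+ n) (f ^+ n).
Proof.
move=> pf; elim: n => [|n IH]; last by rewrite !exprS; apply: agreeM.
by move=> k _; rewrite !expr0 coef1 fpsE1.
Qed.

Fact fpsC_additive : zmod_morphism fpsC.
Proof. by move=> a b; apply: fpsP => -[|k] //=; rewrite subr0. Qed.

HB.instance Definition _ := GRing.isZmodMorphism.Build K (fps K) fpsC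
  fpsC_additive.

Lemma fpsE_C a f k : (fpsC a * f) k = a * f k.
Proof.
rewrite fpsEM big_ord_recl /= subn0 big1 ?addr0 // => i _.
by rewrite mul0r.
Qed.

Fact fpsC_monoid : monoid_morphism fpsC.
Proof.
split=> // a b; apply: fpsP => k; rewrite fpsE_C.
by case: k => //= k; rewrite mulr0.
Qed.

HB.instance Definition _ := GRing.isMonoidMorphism.Build K (fps K) fpsC
  fpsC_monoid.

Definition fpsX : fps K := Fps (fun k => (k == 1)%:R).

Lemma fpsE_X0 f : (fpsX * f) 0%N = 0.
Proof. by rewrite fpsEM big_ord1 /= mul0r. Qed.

Lemma fpsE_X f k : (fpsX * f) k.+1 = f k.
Proof.
rewrite fpsEM 2!big_ord_recl /= mul0r add0r mul1r subSS subn0.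
by rewrite big1 ?addr0 // => i _; rewrite mul0r.
Qed.

Definition fshift f : fps K := Fps (fun k => f k.+1).

Lemma fpsX_shift f : f 0%N = 0 -> f = fpsX * fshift f.
Proof. by move=> f0; apply: fpsP => -[|k]; rewrite ?fpsE_X0 ?fpsE_X. Qed.

Definition fscale c f : fps K := Fps (fun k => c ^+ k * f k).

Lemma fscaleE c f k : fscale c f k = c ^+ k * f k. Proof. by []. Qed.

Fact fscale_additive c : zmod_morphism (fscale c).
Proof. by move=> f g; apply: fpsP => k /=; rewrite mulrDr mulrN. Qed.

HB.instance Definition _ c := GRing.isZmodMorphism.Build (fps K) (fps K)
  (fscale c) (fscale_additive c).

Fact fscale_monoid c : monoid_morphism (fscale c).
Proof.
split=> [|f g]; apply: fpsP => k /=.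
  by case: k => [|k]; rewrite ?expr0 ?mulr1 ?mulr0.
rewrite big_distrr /=; apply: eq_bigr => i _.
have -> : c ^+ k = c ^+ i * c ^+ (k - i) by rewrite -exprD subnKC // -ltnS.
by rewrite mulrACA.
Qed.

HB.instance Definition _ c := GRing.isMonoidMorphism.Build (fps K) (fps K)
  (fscale c) (fscale_monoid c).

Lemma fscaleX c : fscale c fpsX = fpsC c * fpsX.
Proof.
apply: fpsP => k; rewrite fpsE_C /=.
by case: eqP => [->|]; rewrite ?expr1 // !mulr0.
Qed.

Lemma fscaleC c a : fscale c (fpsC a) = fpsC a.
Proof. by apply: fpsP => -[|k] /=; rewrite ?expr0 ?mul1r ?mulr0. Qed.

(** The Euler operator [z d/dz]. It preserves degrees, so that the absence of
    residue of a derivative becomes a statement about one coefficient. *)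
Definition theta f : fps K := Fps (fun k => f k *+ k).

Lemma fpsE_theta f k : theta f k = f k *+ k. Proof. by []. Qed.

Lemma thetaD f g : theta (f + g) = theta f + theta g.
Proof. by apply: fpsP => k /=; rewrite mulrnDl. Qed.

Lemma thetaN f : theta (- f) = - theta f.
Proof. by apply: fpsP => k /=; rewrite mulNrn. Qed.

Lemma thetaM f g : theta (f * g) = theta f * g + f * theta g.
Proof.
apply: fpsP => k; rewrite fpsED /= -sumrMnl -big_split /=.
apply: eq_bigr => i _; rewrite mulrnAl mulrnAr -mulrnDr subnKC //.
by rewrite -ltnS.
Qed.

Lemma thetaC a : theta (fpsC a) = 0.
Proof. by apply: fpsP => -[|k] /=; rewrite ?mulr0n ?mul0rn. Qed.

Lemma theta1 : theta 1 = 0.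
Proof. exact: thetaC. Qed.

Lemma thetaX : theta fpsX = fpsX.
Proof. by apply: fpsP => -[|[|k]] //=; rewrite mul0rn. Qed.

(** Multiplying by [f] avoids the exponent [k - 1] in the power rule. *)
Lemma theta_exp f k : theta (f ^+ k) * f = f ^+ k * theta f *+ k.
Proof.
elim: k => [|k IH]; first by rewrite expr0 theta1 mul0r.
rewrite exprS thetaM mulrDl -[f * _ * f]mulrA IH mulrS mulrnAr.
by congr (_ + _ *+ _); ring.
Qed.

Definition even_fps f := forall k, odd k -> f k = 0.

Lemma even_fpsM f g : even_fps f -> even_fps g -> even_fps (f * g).
Proof.
move=> ef eg k ok; rewrite fpsEM big1 // => i _.
case oi: (odd i); first by rewrite ef ?mul0r.
by rewrite eg ?mulr0 // oddB ?ok ?oi // -ltnS.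
Qed.

Lemma even_fpsX f n : even_fps f -> even_fps (f ^+ n).
Proof.
move=> ef; elim: n => [|n IH]; last by rewrite exprS; apply: even_fpsM.
by move=> [|k].
Qed.

End FpsRing.
Arguments fpsX {K}.

Section FpsField.
Variable K : fieldType.
Implicit Types f g h : fps K.

Lemma fps_neq0 f k : f k != 0 -> f != 0.
Proof. by apply: contra_neq => ->. Qed.

(** The lowest coefficients of two nonzero series multiply to the lowest
    coefficient of their product. *)
Lemma fps_mulI f : f != 0 -> injective ( *%R f).
Proof.
have ex g : g != 0 -> exists k, g k != 0.
  move=> /eqP g0; apply/not_existsP => H; apply: g0; apply: fpsP => k.
  by apply/eqP/negP => /negP /H.
move=> f0 g h /eqP; rewrite -subr_eq0 -mulrBr => /eqP fgh; apply/eqP.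
rewrite -subr_eq0; apply/negP => /negP gh0; move: fgh.
case: (ex_minnP (ex _ f0)) => m fm mmin.
case: (ex_minnP (ex _ gh0)) => n gn nmin.
move=> /(congr1 (fun f : fps K => f (m + n)%N)).
rewrite fpsEM fpsE0.
rewrite (bigD1 (inord m : 'I_(m + n).+1)) // inordK; last by lia.
rewrite addKn big1 => [|i]; last first.
  move=> im0; have im : nat_of_ord i <> m.
    by move=> im; move/eqP: im0; apply; apply: val_inj; rewrite /= inordK //; lia.
  case: (ltnP i m) => im'.
    case: (eqVneq (f i) 0) => [->|/mmin]; first by rewrite mul0r.
    by lia.
  case: (eqVneq ((g - h) (m + n - i)%N) 0) => [->|/nmin]; first by rewrite mulr0.
  by have := ltn_ord i; lia.
change (f m * (g - h) n + 0 = 0 -> False).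
by move/eqP; rewrite addr0 mulf_eq0 (negPf fm) (negPf gn).
Qed.

(** The geometric series of [1 - f / f 0], whose powers have order at least
    their exponent: finitely many of them contribute to a coefficient. *)
Definition finv f : fps K :=
  let u := 1 - fpsC (f 0%N)^-1 * f in
  Fps (fun k => (f 0%N)^-1 * (\sum_(i < k.+1) u ^+ i) k).

Lemma fps_exp_low (u : fps K) n k : u 0%N = 0 -> (k < n)%N -> (u ^+ n) k = 0.
Proof.
move=> u0; rewrite (fpsX_shift u0) exprMn; move: (fshift u ^+ n) => h.
elim: n k => [|n IH] k // kn; rewrite exprS -mulrA.
by case: k kn => [|k] kn; rewrite ?fpsE_X0 // fpsE_X IH.
Qed.

Lemma mul_finv f : f 0%N != 0 -> f * finv f = 1.
Proof.
move=> f0; apply: fpsP => k.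
set u := 1 - fpsC (f 0%N)^-1 * f.
have u0 : u 0%N = 0 by rewrite /u fpsEB fpsE_C fpsE1 mulVf // subrr.
transitivity ((f * (fpsC (f 0%N)^-1 * \sum_(i < k.+1) u ^+ i)) k).
  rewrite !fpsEM; apply: eq_bigr => i _; congr (_ * _).
  rewrite fpsE_C /=; congr (_ * _); rewrite !fpsE_sum.
  rewrite -(big_mkord xpredT (fun j => (u ^+ j) (k - i)%N)).
  rewrite -(big_mkord xpredT (fun j => (u ^+ j) (k - i)%N)).
  rewrite [RHS](@big_cat_nat _ _ _ (k - i).+1) //=; last by lia.
  rewrite [X in _ + X]big_nat_cond [X in _ + X]big1 ?addr0 // => j.
  by rewrite andbT => /andP[H _]; rewrite fps_exp_low.
have -> : f * (fpsC (f 0%N)^-1 * \sum_(i < k.+1) u ^+ i) = 1 - u ^+ k.+1.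
  rewrite -[in RHS](expr1n (fps K) k.+1) subrXX.
  under [in RHS]eq_bigr do rewrite expr1n mul1r.
  rewrite mulrA; congr (_ * _); rewrite /u; ring.
by rewrite fpsEB fps_exp_low // subr0.
Qed.

End FpsField.

Section FpsExp.
Variable K : numFieldType.
Implicit Types (f g h : fps K) (a b c : K).

Definition fexp c : fps K := Fps (fun k => c ^+ k / k`!%:R).

Lemma factr_neq0 n : n`!%:R != 0 :> K.
Proof. by rewrite pnatr_eq0 -lt0n fact_gt0. Qed.

Lemma fexp_coef0 c : fexp c 0%N = 1.
Proof. by rewrite /= expr0 fact0 divr1. Qed.

Lemma fexpD a b : fexp (a + b) = fexp a * fexp b.
Proof.
apply: fpsP => k; rewrite fpsEM /= addrC exprDn mulr_suml; apply: eq_bigr => i _.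
have ik : (i <= k)%N by rewrite -ltnS.
rewrite -(bin_fact ik) -[_ *+ _]mulr_natr !natrM.
have := factr_neq0 i; have := factr_neq0 (k - i).
have : 'C(k, i)%:R != 0 :> K by rewrite pnatr_eq0 -lt0n bin_gt0.
by move=> h1 h2 h3; field; rewrite h1 h2 h3.
Qed.

Lemma fexp0 : fexp 0 = 1.
Proof.
apply: fpsP => k; rewrite fpsE1 /= expr0n.
by case: k => [|k]; rewrite /= ?fact0 ?divr1 // mul0r.
Qed.

Lemma fexp_expn c n : fexp c ^+ n = fexp (n%:R * c).
Proof.
elim: n => [|n IH]; first by rewrite mul0r fexp0.
by rewrite exprS IH -fexpD -natr1 mulrDl mul1r addrC.
Qed.

Lemma fexpN c : fexp c * fexp (- c) = 1.
Proof. by rewrite -fexpD subrr fexp0. Qed.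

Lemma fexp_scale c a : fscale c (fexp a) = fexp (c * a).
Proof. by apply: fpsP => k /=; rewrite exprMn mulrA. Qed.

Lemma theta_fexp c : theta (fexp c) = fpsC c * fpsX * fexp c.
Proof.
apply: fpsP => -[|k]; rewrite -mulrA fpsE_C ?fpsE_X0 ?mulr0 // fpsE_X /=.
rewrite factS natrM exprS -[_ *+ _]mulr_natr.
have := factr_neq0 k; have : k.+1%:R != 0 :> K by rewrite pnatr_eq0.
by move: k.+1%:R => x h1 h2; field; rewrite h1 h2.
Qed.

End FpsExp.

(** * The residue at the origin *)
Section Residue.
Variable K : numFieldType.
Variables (c : K) (W : fps K).
Hypotheses (c0 : c != 0) (evenW : even_fps W).
Let v := fexp c.
Hypothesis W_eq : W * (v - 1) ^+ 2 = - 4%:R * fpsX ^+ 2 * v.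
(* [q = z / (v - 1)] and [Y = z (v + 1) / (v - 1)], which is [z] times a
   cotangent up to constants. *)
Let q := finv (fshift (v - 1)).
Let Y := q * (v + 1).

Lemma fexp_sub1_coef0 : (v - 1) 0%N = 0.
Proof. by rewrite fpsEB fexp_coef0 subrr. Qed.

Lemma fexp_sub1_coef1 : (v - 1) 1%N = c.
Proof. by rewrite fpsEB fpsE1 subr0 /= expr1 divr1. Qed.

Lemma fexp_sub1_neq0 : v - 1 != 0.
Proof. by apply: (@fps_neq0 _ _ 1%N); rewrite fexp_sub1_coef1. Qed.

Lemma mul_sub1_q : (v - 1) * q = fpsX.
Proof.
rewrite [v - 1](fpsX_shift fexp_sub1_coef0) -mulrA mul_finv ?mulr1 //.
by rewrite [_ != _](_ : _ = ((v - 1) 1%N != 0)) // fexp_sub1_coef1.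
Qed.

Lemma mul_sub1_Y : (v - 1) * Y = fpsX * (v + 1).
Proof. by rewrite /Y mulrA mul_sub1_q. Qed.

Lemma Y_coef0 : Y 0%N = 2 / c.
Proof.
have H : fshift (v - 1) * Y = v + 1.
  have X0 : fpsX != 0 :> fps K by apply: (@fps_neq0 _ _ 1%N); rewrite oner_eq0.
  by apply: (fps_mulI X0); rewrite mulrA -fpsX_shift ?fexp_sub1_coef0 ?mul_sub1_Y.
have S0 : fshift (v - 1) 0%N = c by exact: fexp_sub1_coef1.
have := congr1 (fun f : fps K => f 0%N) H.
by rewrite fpsE_M0 S0 fpsED fexp_coef0 fpsE1 => /(canRL (mulKf c0)) ->; rewrite mulrC.
Qed.

(** The logarithmic derivative of [W = - 4 z^2 v / (v - 1)^2], read off the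
    equation that defines [W]. *)
Lemma theta_W : theta W = 2%:R * W - fpsC c * W * Y.
Proof.
apply: (fps_mulI fexp_sub1_neq0); apply: (fps_mulI fexp_sub1_neq0).
have tv : theta (v - 1) = fpsC c * fpsX * v.
  by rewrite thetaD thetaN theta1 subr0 theta_fexp.
have t4 : theta (- 4%:R : fps K) = 0.
  by rewrite -[4%:R](rmorph_nat (@fpsC K)) thetaN thetaC oppr0.
have -> : (v - 1) * ((v - 1) * theta W) =
    theta (W * (v - 1) ^+ 2) - 2%:R * W * (fpsC c * fpsX * v * (v - 1)).
  by rewrite expr2 !thetaM tv; ring.
have -> : (v - 1) * ((v - 1) * (2%:R * W - fpsC c * W * Y)) =
  2%:R * (W * (v - 1) ^+ 2) - fpsC c * W * (v - 1) * ((v - 1) * Y) by ring.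
rewrite mul_sub1_Y W_eq expr2 !thetaM t4 thetaX theta_fexp -/v mul0r add0r.
have -> : - 4%:R * (fpsX * fpsX) * (fpsC c * fpsX * v) =
  fpsC c * fpsX * (W * (v - 1) ^+ 2) by rewrite W_eq; ring.
ring.
Qed.

(** The function [W^k Y / z^(2k + 1)] is a multiple of the derivative of
    [(W / z^2)^k], so it has no residue. The statement fails for [k = 0], where
    that multiple is infinite. *)
Lemma coef_WY k : (0 < k)%N -> (W ^+ k * Y) (2 * k)%N = 0.
Proof.
move=> k0.
have W0 : W != 0.
  apply/eqP => W0; move: W_eq; rewrite W0 mul0r.
  move/(congr1 (fun f : fps K => f 2)).
  rewrite -[4%:R](rmorph_nat (@fpsC K)) -rmorphN -mulrA fpsE_C expr2 -mulrA.
  by rewrite !fpsE_X fexp_coef0 mulr1 => /esym/eqP; rewrite oppr_eq0 pnatr_eq0.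
have : theta (W ^+ k) = (2%:R * W ^+ k - fpsC c * (W ^+ k * Y)) * k%:R.
  apply: (fps_mulI W0); rewrite mulrC theta_exp theta_W -mulr_natr; ring.
move/(congr1 (fun f : fps K => f (2 * k)%N)).
rewrite -!(rmorph_nat (@fpsC K)) [_ * fpsC k%:R]mulrC fpsE_C fpsEB !fpsE_C.
rewrite fpsE_theta -[_ *+ (2 * k)]mulr_natr natrM => H.
have k0' : k%:R != 0 :> K by rewrite pnatr_eq0 -lt0n.
have : k%:R * c * (W ^+ k * Y) (2 * k)%N = 0.
  rewrite [_ * _ * _](_ : _ = 2%:R * k%:R * (W ^+ k) (2 * k)%N
     - k%:R * (2%:R * (W ^+ k) (2 * k)%N - c * (W ^+ k * Y) (2 * k)%N));
  last by ring.
  by rewrite -H; ring.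
by move/eqP; rewrite !mulf_eq0 (negPf c0) (negPf k0') => /eqP.
Qed.

(** Since [W (v - 1) = - 2 z^2 - 2 z Y], the coefficient splits into an odd
    coefficient of the even series [W^n] and one covered by [coef_WY]. For
    [n = 0] the simple pole of [Y / z] remains. *)
Lemma coef_W_sub1 n :
  (W ^+ n.+1 * (v - 1)) (2 * n).+1 = if n is 0 then - 4 / c else 0.
Proof.
have Wv : W * (v - 1) = - (fpsX * (2%:R * (fpsX * 1 + Y))).
  apply: (fps_mulI fexp_sub1_neq0).
  rewrite [LHS](_ : _ = W * (v - 1) ^+ 2);
  last by ring.
  rewrite [RHS](_ : _ = - 2%:R * (fpsX * (fpsX * (v - 1) + (v - 1) * Y)));
  last by ring.
  by rewrite W_eq mul_sub1_Y; ring.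
rewrite exprSr -mulrA Wv mulrN fpsEN mulrCA fpsE_X.
rewrite -[2%:R](rmorph_nat (@fpsC K)) mulrCA fpsE_C mulrDr fpsED.
rewrite mulrCA mulr1.
case: n => [|n].
  rewrite muln0 fpsE_X0 expr0 mul1r add0r Y_coef0; by field.
rewrite coef_WY // addr0 [(2 * n.+1)%N]mulnS add2n fpsE_X.
by rewrite (even_fpsX _ evenW) ?mulr0 ?oppr0 //= oddM.
Qed.

(** The squared cosecant of [theta] in the coordinate [w = e^(2 i theta)]. *)
Definition kappa (w : K) := - 4 * w / (w - 1) ^+ 2.

(** The residue at [0] of [kappa v ^ (n + 1) v / (w - v)]. Its value is minus the residue at the pole [v = w], and the
    induction on [n] replaces the contour argument. *)
Lemma coef_residue w n : w != 1 ->
  (W ^+ n.+1 * (v * finv (fpsC w - v))) (2 * n).+1 = kappa w ^+ n.+1 / c.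
Proof.
move=> w1; set L := finv _.
have w1' : w - 1 != 0 by rewrite subr_eq0.
have wv : (fpsC w - v) * L = 1.
  by rewrite mul_finv // fpsEB fexp_coef0.
have wv0 : fpsC w - v != 0.
  by apply/eqP => H; move/eqP: wv; rewrite H mul0r eq_sym oner_eq0.
set a := (w - 1)^-1.
have ab : fpsC a * (fpsC w - 1) = 1.
  by rewrite -[X in fpsC w - X](rmorph1 (@fpsC K)) -rmorphB -rmorphM mulVf.
(* This is [z^2 (kappa v - kappa w) v / (w - v)] with [w - v] cancelled. *)
have step : W * (v * L) = fpsC (kappa w) * (fpsX * (fpsX * (v * L)))
  + fpsC a * W + fpsC (w * a ^+ 2) * (W * (v - 1)).
  apply: (fps_mulI fexp_sub1_neq0); apply: (fps_mulI fexp_sub1_neq0).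
  apply: (fps_mulI wv0).
  have -> : kappa w = - 4%:R * (w * a ^+ 2) by rewrite /kappa /a exprVn mulrA.
  have -> : (fpsC w - v) * ((v - 1) * ((v - 1) * (W * (v * L)))) =
    W * (v - 1) ^+ 2 * v * ((fpsC w - v) * L) by ring.
  rewrite rmorphM rmorphN rmorph_nat.
  have -> : (fpsC w - v) * ((v - 1) * ((v - 1) *
     (- 4%:R * fpsC (w * a ^+ 2) * (fpsX * (fpsX * (v * L))) + fpsC a * W +
       fpsC (w * a ^+ 2) * (W * (v - 1))))) =
    - 4%:R * fpsC (w * a ^+ 2) * fpsX ^+ 2 * v * (v - 1) ^+ 2 * ((fpsC w - v) * L)
    + (W * (v - 1) ^+ 2) * (fpsC w - v) *
       (fpsC a + fpsC (w * a ^+ 2) * (v - 1)) by ring.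
  rewrite wv W_eq rmorphM rmorphXn !mulr1.
  apply/eqP; rewrite -subr_eq0.
  set L1 := (X in X == 0).
  have -> : L1 = (- 4%:R * fpsX ^+ 2 * v) * (1 - fpsC a * (fpsC w - 1)) *
     (fpsC w * fpsC a * (v - 1) + v) by rewrite /L1; ring.
  by rewrite ab subrr mulr0 mul0r.
elim: n => [|n IH].
  rewrite expr1 step muln0 !fpsED !fpsE_C fpsE_X fpsE_X0 evenW //.
  have := coef_W_sub1 0; rewrite expr1 muln0 => ->.
  by rewrite !mulr0 !add0r expr1 /kappa /a exprVn; field; rewrite c0.
rewrite exprSr -mulrA step 2![W ^+ _ * (_ + _)]mulrDr.
rewrite [_ * (fpsC (kappa w) * _)]mulrCA [_ * (fpsC a * _)]mulrCA.
rewrite [_ * (fpsC (_ * _) * _)]mulrCA !fpsED !fpsE_C.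
rewrite [W ^+ _ * (W * _)]mulrA -!exprSr coef_W_sub1 mulr0 addr0.
have o : odd (2 * n.+1).+1 by rewrite oddS oddM.
rewrite (even_fpsX _ evenW o) mulr0 addr0.
rewrite mulrCA [W ^+ _ * (_ * _)]mulrCA.
by rewrite fpsE_X mulnS add2n fpsE_X IH mulrA -exprS.
Qed.

Variables (d m : nat) (T : K) (w : 'I_d -> K).
Hypotheses (m0 : (0 < m)%N) (md : (m < d)%N) (T0 : T != 0) (T1 : T != 1).
Hypotheses (wT : forall j, w j ^+ d = T).
Hypotheses (w_sum : forall p, (0 < p < d)%N -> \sum_j w j ^+ p = 0).

Lemma root_neq1 j : w j != 1.
Proof. by apply: contraNneq T1 => w1; rewrite -(wT j) w1 expr1n. Qed.

(** Partial fractions over the roots of [w ^ d = T]. After multiplication by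
    [T - v ^ d] each summand is a geometric sum in [v], and summation over the
    roots kills all powers of [v] but one. *)
Lemma sum_resolvent (Q : fps K) : (fpsC T^-1 * v ^+ d - 1) * Q = 1 ->
  d%:R * v ^+ m * Q =
  - \sum_j fpsC (w j ^+ m) * (v * finv (fpsC (w j) - v)).
Proof.
move=> HQ.
have Tv0 : fpsC T - v ^+ d != 0.
  apply: (@fps_neq0 _ _ 0%N); rewrite fexp_expn fpsEB fexp_coef0.
  by rewrite subr_eq0.
apply: (fps_mulI Tv0).
have TQ : (fpsC T - v ^+ d) * Q = - fpsC T.
  have -> : fpsC T - v ^+ d = - fpsC T * (fpsC T^-1 * v ^+ d - 1).
    rewrite mulrBr mulr1 mulrA mulNr -rmorphM mulfV // rmorph1; ring.
  by rewrite -mulrA HQ mulr1.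
rewrite mulrCA TQ !mulrN; congr (- _).
have wv j : (fpsC (w j) - v) * finv (fpsC (w j) - v) = 1.
  by rewrite mul_finv // fpsEB fexp_coef0 subr_eq0 root_neq1.
rewrite mulr_sumr.
(* In degree [l] the exponent of [w] is [m + (d - 1 - l)]. It lies strictly
   between [0] and [2d], and it equals [d] only for [l = m - 1]. *)
transitivity (\sum_j \sum_(l < d) fpsC (w j ^+ (m + (d.-1 - l))) * v ^+ l.+1).
  rewrite exchange_big /=.
  have lm : (m.-1 < d)%N by lia.
  rewrite (bigD1 (Ordinal lm)) //= [X in _ + X]big1 => [|l lm'].
    rewrite addr0 -big_distrl /= (_ : (m + (d.-1 - m.-1) = d)%N); last by lia.
    rewrite (prednK m0); under eq_bigr do rewrite wT.
    by rewrite sumr_const card_ord -mulr_natr; ring.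
  rewrite -big_distrl /= -rmorph_sum.
  have lm2 : l <> m.-1 :> nat by move=> H; move/eqP: lm'; apply; apply: val_inj.
  have ld := ltn_ord l.
  case: (ltnP (m + (d.-1 - l)) d) => H.
    by rewrite w_sum ?rmorph0 ?mul0r //; lia.
  rewrite (_ : (m + (d.-1 - l) = d + (m - l.+1))%N); last by lia.
  under eq_bigr do rewrite exprD wT.
  by rewrite -big_distrr /= w_sum ?mulr0 ?rmorph0 ?mul0r //; lia.
apply: eq_bigr => j _.
have -> : fpsC T - v ^+ d = (fpsC (w j) - v) *
   \sum_(l < d) fpsC (w j) ^+ (d.-1 - l) * v ^+ l.
  by rewrite -subrXX -rmorphXn /= wT.
set S := (X in _ = _ * X * _); set L := finv _.
have -> : (fpsC (w j) - v) * S * (fpsC (w j ^+ m) * (v * L)) =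
  ((fpsC (w j) - v) * L) * (fpsC (w j ^+ m) * v * S) by ring.
rewrite wv mul1r mulr_sumr; apply: eq_bigr => l _.
by rewrite exprD rmorphM !rmorphXn exprS /=; ring.
Qed.

Lemma coef_root_sum n (Q : fps K) : (fpsC T^-1 * v ^+ d - 1) * Q = 1 ->
  (W ^+ n.+1 * (d%:R * v ^+ m * Q)) (2 * n).+1 =
  - \sum_j w j ^+ m * kappa (w j) ^+ n.+1 / c.
Proof.
move=> HQ; rewrite (sum_resolvent HQ) mulrN mulr_sumr fpsEN fpsE_sum.
congr (- _); apply: eq_bigr => j _.
by rewrite mulrCA fpsE_C coef_residue ?root_neq1 // mulrA.
Qed.

End Residue.


(** * Sums of power series near the origin *)
Section PowerSeries.
Local Open Scope classical_set_scope.
Variable K : numFieldType.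
(* An archimedean condition, without which geometric series need not
   converge. *)
Hypothesis half_small : forall e : K, 0 < e -> exists n, 2^-1 ^+ n < e.
Implicit Types (f g : fps K) (z s B C D L : K).

Definition sums_to f z s := series (fun k => f k * z ^+ k) @ \oo --> s.

Lemma half_ge0 n : 0 <= 2^-1 ^+ n :> K.
Proof. by rewrite exprn_ge0 // invr_ge0 ler0n. Qed.

Lemma half_cvg0 : (fun n => 2^-1 ^+ n : K) @ \oo --> (0 : K).
Proof.
apply/cvgrPdist_lt => e e0; have [N HN] := half_small e0.
near=> n; rewrite sub0r normrN ger0_norm ?half_ge0 //.
apply: le_lt_trans HN; have Nn : (N <= n)%N by near: n; exists N.
by apply: ler_wiXn2l => //; rewrite ?invr_ge0 ?ler0n // invf_le1 ?ler1n ?ltr0n.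
Unshelve. all: by end_near. Qed.

Lemma sum_half n : \sum_(i < n) 2^-1 ^+ i <= 2 :> K.
Proof.
have := subrX1 (2^-1 : K) n; set S := \sum_(i < n) _ => H.
have -> : S = 2 - 2 * 2^-1 ^+ n.
  have h2 : 2%:R != 0 :> K by rewrite pnatr_eq0.
  rewrite [LHS](_ : _ = - 2 * ((2^-1 - 1) * S)); last by field.
  by rewrite -H; ring.
by rewrite lerBlDr lerDl mulr_ge0 ?half_ge0 ?ler0n.
Qed.

Lemma cvg0_le (u v : nat -> K) B : (forall n, `|u n| <= B * `|v n|) ->
  v @ \oo --> (0 : K) -> u @ \oo --> (0 : K).
Proof.
move=> uv /cvgrPdist_lt v0; apply/cvgrPdist_lt => e e0.
have B1 : 0 < `|B| + 1 by rewrite ltr_wpDl.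
near=> n; rewrite sub0r normrN.
have : `|0 - v n| < e / (`|B| + 1).
  by near: n; apply: v0; rewrite divr_gt0.
rewrite sub0r normrN ltr_pdivlMr // => H; apply: le_lt_trans H.
have [vn0|vn0] := eqVneq `|v n| 0.
  by have := uv n; rewrite vn0 mulr0 mul0r.
have vn : 0 < `|v n| by rewrite lt_def vn0 normr_ge0.
have Br : 0 <= B by rewrite -(pmulr_lge0 _ vn) (le_trans _ (uv n)).
apply: le_trans (uv n) _; rewrite mulrC ler_pM2l // ger0_norm //.
by rewrite lerDl.
Unshelve. all: by end_near. Qed.

(** The ratio [L = 1 + C / |f 0|] is chosen so that the recurrence for the
    coefficients of [g] reproduces the bound exactly: the sum of [L ^ i] over
    [i < k] times [C / |f 0|] is [L ^ k - 1]. *)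
Lemma inverse_growth f g C : f * g = 1 -> f 0%N != 0 ->
  (forall k, `|f k| <= C) ->
  exists D L : K, [/\ 0 <= D, 1 <= L & forall k, `|g k| <= D * L ^+ k].
Proof.
move=> fg f0 fC; exists `|f 0%N|^-1, (1 + C / `|f 0%N|).
have f0' : 0 < `|f 0%N| by rewrite normr_gt0.
have C0 : 0 < C by exact: lt_le_trans (fC 0%N).
set D := _^-1; set L := 1 + _.
have D0 : 0 < D by rewrite invr_gt0.
have L1 : 1 <= L by rewrite lerDl divr_ge0 // ltW.
split => //; first exact: ltW.
elim/ltn_ind => -[|k] IH.
  have := congr1 (fun h : fps K => h 0%N) fg.
  rewrite fpsE_M0 fpsE1 /= => /(canRL (mulKf f0)) ->.
  by rewrite mulr1 normfV expr0 mulr1.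
have := congr1 (fun h : fps K => h k.+1) fg.
rewrite fpsEM fpsE1 big_ord_recl subn0 => /eqP; rewrite addr_eq0 => /eqP H.
rewrite -(ler_pM2l f0') -normrM H normrN mulrA mulfV ?gt_eqF // mul1r.
apply: le_trans (ler_norm_sum _ _ _) _.
apply: (@le_trans _ _ (\sum_(i < k.+1) C * (D * L ^+ (k.+1 - i.+1)))).
  apply: ler_sum => i _; rewrite normrM ler_pM //.
  have ik := ltn_ord i.
  by rewrite lift0; apply: IH; lia.
rewrite -mulr_sumr -mulr_sumr.
rewrite -(big_mkord xpredT (fun i => L ^+ (k.+1 - i.+1))) big_rev_mkord subn0.
rewrite (eq_bigr (fun i : 'I_k.+1 => L ^+ i)) => [|i _]; last first.
  by have ik := ltn_ord i; congr (_ ^+ _); lia.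
have -> : C * (D * \sum_(i < k.+1) L ^+ i) = L ^+ k.+1 - 1.
  by rewrite subrX1 mulrA; congr (_ * _); rewrite /L /D; ring.
by rewrite lerBlDr lerDl.
Qed.

Lemma leq_2expn_r k : k.+1%:R <= 2 ^+ k :> K.
Proof. by rewrite -natrX ler_nat ltn_expl. Qed.

(** The product of two partial sums is a polynomial in [z] whose coefficients
    below degree [n + 1] are those of [f * g = 1]. In degree [k] above that
    there are at most [k + 1 <= 2 ^ k] terms, each at most [C D 4 ^ -k], which
    leaves a geometric tail of ratio [1 / 2]. *)
Lemma partial_inverse f g C D L z n : f * g = 1 ->
  (forall k, `|f k| <= C) -> 0 <= D -> 1 <= L ->
  (forall k, `|g k| <= D * L ^+ k) -> `|z| * L <= 4^-1 ->
  `|series (fun k => f k * z ^+ k) n.+1 * series (fun k => g k * z ^+ k) n.+1 - 1|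
    <= 2 * C * D * 2^-1 ^+ n.+1.
Proof.
move=> fg fC D0 L1 gD zL; set N := n.+1.
have C0 : 0 <= C by exact: le_trans (fC 0%N).
have L0 : 0 <= L by exact: le_trans L1.
have ser (h : fps K) : series (fun k => h k * z ^+ k) N = (ftrunc N h).[z].
  by rewrite /series /= big_mkord horner_poly.
rewrite !ser -hornerM; set p := _ * _.
have sp : (size p <= N + N)%N.
  apply: leq_trans (size_polyMleq _ _) _; rewrite -subn1 leq_subLR add1n.
  by apply: leqW; apply: leq_add; apply: size_poly.
rewrite (horner_coef_wide _ sp) big_split_ord /=.
rewrite (bigD1 (Ordinal (ltn0Sn n))) //= [X in _ + X + _ - _]big1 => [|i i0].
  rewrite coef_ftruncM // fg fpsE1 expr0 mulr1 addr0 addrAC subrr add0r.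
  apply: le_trans (ler_norm_sum _ _ _) _.
  apply: (@le_trans _ _ (\sum_(i < N) C * D * 2^-1 ^+ (N + i))).
    apply: ler_sum => i _; set k := (N + i)%N.
    rewrite normrM normrX.
    have pk : `|p`_k| <= k.+1%:R * (C * (D * L ^+ k)).
      rewrite coefM; apply: le_trans (ler_norm_sum _ _ _) _.
      rewrite -[k.+1 in leRHS]card_ord mulr_natl -sumr_const; apply: ler_sum => j _.
      rewrite normrM ler_pM // !coef_poly.
        by case: ifP => _; rewrite ?normr0.
      case: ifP => _; last by rewrite normr0 mulr_ge0 // exprn_ge0.
      apply: le_trans (gD _) _; rewrite ler_wpM2l //.
      by apply: ler_weXn2l => //; exact: leq_subr.
    apply: (@le_trans _ _ (2 ^+ k * (C * (D * L ^+ k)) * `|z| ^+ k)).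
      rewrite ler_wpM2r ?exprn_ge0 //; apply: le_trans pk _.
      by rewrite ler_wpM2r ?leq_2expn_r // !mulr_ge0 // exprn_ge0.
    have -> : 2 ^+ k * (C * (D * L ^+ k)) * `|z| ^+ k =
       C * D * (2 * (`|z| * L)) ^+ k by rewrite !exprMn; ring.
    rewrite ler_wpM2l ?mulr_ge0 // lerXn2r ?nnegrE ?mulr_ge0 ?invr_ge0 ?ler0n //.
    have -> : 2^-1 = 2 * 4^-1 :> K.
      have h2 : 2%:R != 0 :> K by rewrite pnatr_eq0.
      have h4 : 4%:R != 0 :> K by rewrite pnatr_eq0.
      by field.
    by rewrite ler_wpM2l ?ler0n.
  under eq_bigr do rewrite exprD mulrA.
  rewrite -mulr_sumr.
  have -> : 2 * C * D * 2^-1 ^+ N = C * D * 2^-1 ^+ N * 2 by ring.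
  by rewrite ler_wpM2l ?sum_half // !mulr_ge0 ?half_ge0.
rewrite coef_ftruncM // fg fpsE1 (_ : _ == _ = false) ?mul0r //.
by apply/negP => /eqP H; move/eqP: i0; apply; apply: val_inj.
Qed.

(** The partial sums of [g] stay bounded, so their products with [s] tend to
    [1] like the products of partial sums. This shows at the same time that
    [s != 0] and that the sums of [g] converge, without completeness. *)
Lemma inverse_sums_to f g C : f * g = 1 -> f 0%N != 0 ->
  (forall k, `|f k| <= C) ->
  exists2 r : K, 0 < r & forall z s, `|z| < r -> sums_to f z s ->
    sums_to g z s^-1.
Proof.
move=> fg f0 fC; have [D [L [D0 L1 gD]]] := inverse_growth fg f0 fC.
have L0 : 0 < L by exact: lt_le_trans L1.
exists (4^-1 / L) => [|z s]; first by rewrite divr_gt0 // invr_gt0 ltr0n.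
rewrite ltr_pdivlMr // => /ltW zL fs.
have ser_g n : `|series (fun k => g k * z ^+ k) n| <= D * 2.
  rewrite /series /= big_mkord; apply: le_trans (ler_norm_sum _ _ _) _.
  apply: (@le_trans _ _ (D * \sum_(i < n) 2^-1 ^+ i)); last first.
    by rewrite ler_wpM2l // sum_half.
  rewrite mulr_sumr; apply: ler_sum => i _; rewrite normrM normrX.
  apply: (@le_trans _ _ (D * L ^+ i * `|z| ^+ i)).
    by rewrite ler_wpM2r // exprn_ge0.
  rewrite -mulrA -exprMn mulrC [_ * D]mulrC ler_wpM2l //.
  rewrite lerXn2r ?nnegrE ?mulr_ge0 ?invr_ge0 ?ler0n //; first exact: ltW.
  rewrite mulrC; apply: le_trans zL _.
  by rewrite lef_pV2 ?posrE ?ltr0n // ler_nat.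
have lim1 : (fun n => series (fun k => g k * z ^+ k) n * s) @ \oo --> (1 : K).
  have d0 : (fun n => series (fun k => g k * z ^+ k) n *
      (s - series (fun k => f k * z ^+ k) n)) @ \oo --> (0 : K).
    apply: (@cvg0_le _ (fun n => s - series (fun k => f k * z ^+ k) n) (D * 2)).
      by move=> n; rewrite normrM ler_wpM2r.
    by rewrite -[X in _ --> X](subrr s); apply: cvgB; [exact: cvg_cst | exact: fs].
  have p1 : (fun n => series (fun k => f k * z ^+ k) n *
      series (fun k => g k * z ^+ k) n - 1) @ \oo --> (0 : K).
    rewrite -(cvg_shiftn 1) /=.
    apply: (@cvg0_le _ (fun n => 2^-1 ^+ n.+1) (2 * C * D)) => [n|].
      rewrite addn1 [`|2^-1 ^+ _|]ger0_norm ?half_ge0 //.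
      exact: partial_inverse fg fC D0 L1 gD zL.
    have := half_cvg0; rewrite -(cvg_shiftn 1) /=.
    by under eq_fun do rewrite addn1.
  have : (fun n => series (fun k => g k * z ^+ k) n *
      (s - series (fun k => f k * z ^+ k) n) +
      (series (fun k => f k * z ^+ k) n *
      series (fun k => g k * z ^+ k) n - 1) + 1) @ \oo --> (0 + 0 + 1 : K).
    by apply: cvgD; [apply: cvgD | exact: cvg_cst].
  rewrite !add0r; apply: cvg_trans; apply: near_eq_cvg.
  by near=> n => /=; ring.
have s0 : s != 0.
  apply/eqP => s0; move: lim1; rewrite s0.
  under eq_fun do rewrite mulr0.
  move=> /cvg_lim; move/(_ (@norm_hausdorff _ _)).
  rewrite lim_cst; last exact: norm_hausdorff.
  by move/eqP; rewrite eq_sym oner_eq0.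
have : (fun n => series (fun k => g k * z ^+ k) n * s * s^-1) @ \oo -->
    (1 * s^-1 : K).
  by apply: cvgM; [exact: lim1 | exact: cvg_cst].
rewrite mul1r; apply: cvg_trans; apply: near_eq_cvg.
by near=> n; rewrite mulfK.
Unshelve. all: by end_near. Qed.

Lemma sums_to_bounded f z s : sums_to f z s -> z != 0 ->
  exists C L : K, [/\ 0 <= C, 0 < L & forall k, `|f k| <= C * L ^+ k].
Proof.
move=> fs z0.
have : cvgn (series (fun k => f k * z ^+ k)) by apply/cvg_ex; exists s.
move=> /cvg_series_cvg_0 c0.
have : bounded_fun (fun k => f k * z ^+ k).
  by apply: cvg_seq_bounded; apply/cvg_ex; exists 0.
move=> [M [Mr /(_ (`|M| + 1))]] => HM.
have {}HM k : `|f k * z ^+ k| <= `|M| + 1.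
  apply: HM => //; apply: (@le_lt_trans _ _ `|M|); first exact: real_ler_norm.
  by rewrite ltrDl.
exists (`|M| + 1), `|z|^-1; split => [||k].
- by rewrite addr_ge0.
- by rewrite invr_gt0 normr_gt0.
- by rewrite exprVn ler_pdivlMr ?exprn_gt0 ?normr_gt0 // -normrX -normrM.
Qed.

(** If [f k] is the first nonzero coefficient, the remaining terms are bounded
    by a multiple of [|z| ^ (k + 1)], which cannot compensate [f k z ^ k] for
    small [z]. *)
Lemma fps_eq0_near f : (\forall z \near (0 : K)^', sums_to f z 0) -> f = 0.
Proof.
move=> Hf.
have [z0 [z0f z00]] : exists z, sums_to f z 0 /\ z != 0.
  apply: (@filter_ex _ (0 : K)^').
  near=> z; split; first by near: z.
  by near: z; exact: nbhs_dnbhs_neq.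
have [C [L [C0 L0 fC]]] := sums_to_bounded z0f z00.
apply: fpsP => k; rewrite fpsE0.
elim/ltn_ind: k => k IH; apply/eqP; rewrite -normr_eq0 -[_ == _]negbK.
apply/negP => fk.
have fk0 : 0 < `|f k| by rewrite lt_def fk normr_ge0.
have B0 : 0 < 2 * C * L ^+ k.+1 + 1.
  by rewrite ltr_wpDl // !mulr_ge0 ?ler0n // exprn_ge0 // ltW.
set B := 2 * C * L ^+ k.+1 + 1 in B0.
have [z [zf z1 zL zB]] : exists z : K, [/\ sums_to f z 0, z != 0,
    `|z| < 2^-1 / L & `|z| < `|f k| / B].
  apply: (@filter_ex _ (0 : K)^').
  near=> z; split; first by near: z.
  - by near: z; exact: nbhs_dnbhs_neq.
  - by near: z; apply: dnbhs0_lt; rewrite divr_gt0 // invr_gt0 ltr0n.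
  - by near: z; apply: dnbhs0_lt; rewrite divr_gt0.
have z_gt0 : 0 < `|z| by rewrite normr_gt0.
have : `|f k * z ^+ k| < B * `|z| ^+ k.+1.
  move/cvgrPdist_lt: zf => /(_ (`|z| ^+ k.+1)); rewrite exprn_gt0 // => /(_ isT).
  case=> N _ /(_ (k.+1 + N)%N (leq_addl _ _)); rewrite sub0r normrN.
  rewrite /series /= big_mkord big_split_ord big_ord_recr /= big1 => [|i _]; last first.
    by rewrite IH ?mul0r.
  rewrite add0r; set t := \sum_(i < N) _ => H.
  have tB : `|t| <= 2 * C * L ^+ k.+1 * `|z| ^+ k.+1.
    apply: le_trans (ler_norm_sum _ _ _) _.
    apply: (@le_trans _ _ (C * L ^+ k.+1 * `|z| ^+ k.+1 * \sum_(i < N) 2^-1 ^+ i)).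
      rewrite mulr_sumr; apply: ler_sum => i _; rewrite normrM normrX.
      apply: (@le_trans _ _ (C * L ^+ (k.+1 + i) * `|z| ^+ (k.+1 + i))).
        by rewrite ler_wpM2r // exprn_ge0.
      rewrite !exprD.
      have -> : C * (L ^+ k.+1 * L ^+ i) * (`|z| ^+ k.+1 * `|z| ^+ i) =
        C * L ^+ k.+1 * `|z| ^+ k.+1 * (`|z| * L) ^+ i by rewrite exprMn; ring.
      rewrite ler_wpM2l ?mulr_ge0 ?exprn_ge0 // ?(ltW L0) //.
      rewrite lerXn2r ?nnegrE ?mulr_ge0 ?invr_ge0 ?ler0n ?(ltW L0) //.
      by rewrite -ler_pdivlMr // ltW.
    have -> : 2 * C * L ^+ k.+1 * `|z| ^+ k.+1 =
      C * L ^+ k.+1 * `|z| ^+ k.+1 * 2 by ring.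
    by rewrite ler_wpM2l ?sum_half // !mulr_ge0 ?exprn_ge0 // ltW.
  have -> : f k * z ^+ k = (f k * z ^+ k + t) - t by ring.
  apply: le_lt_trans (ler_normB _ _) _.
  by rewrite /B mulrDl mul1r addrC ler_ltD.
rewrite normrM normrX exprSr mulrCA mulrC ltr_pM2l ?exprn_gt0 //.
move: zB; rewrite ltr_pdivlMr // mulrC => zB fkB.
by have := lt_trans fkB zB; rewrite ltxx.
Unshelve. all: by end_near. Qed.

Lemma sums_toB f g z s t : sums_to f z s -> sums_to g z t ->
  sums_to (f - g) z (s - t).
Proof.
move=> fs gt; have : (fun n => series (fun k => f k * z ^+ k) n -
    series (fun k => g k * z ^+ k) n) @ \oo --> (s - t : K).
  by apply: cvgB; [exact: fs | exact: gt].
apply: cvg_trans; apply: near_eq_cvg.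
near=> n; rewrite /series /= -sumrB; apply: eq_bigr => i _.
by rewrite mulrBl.
Unshelve. all: by end_near. Qed.

Lemma fps_eq_near f g (s : K -> K) :
  (\forall z \near (0 : K)^', sums_to f z (s z)) ->
  (\forall z \near (0 : K)^', sums_to g z (s z)) -> f = g.
Proof.
move=> fs gs; apply/eqP; rewrite -subr_eq0; apply/eqP; apply: fps_eq0_near.
near=> z; rewrite -[X in sums_to _ _ X](subrr (s z)).
by apply: sums_toB; near: z.
Unshelve. all: by end_near. Qed.

End PowerSeries.


(** * The complex exponential *)
Section Complex.
Local Open Scope classical_set_scope.
Variable R : realType.
(* [R[i]] gets its norm topology through its structure of numeric field. *)
Let C : numFieldType := R[i].
Implicit Types (x y : R) (z : R[i]).

Lemma half_small_real (e : R) : 0 < e -> exists n, 2^-1 ^+ n < e.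
Proof.
move=> e0; exists (Num.truncn e^-1).+1.
rewrite exprVn invf_plt ?posrE ?exprn_gt0 //.
apply: lt_trans (truncnS_gt _) _.
by rewrite -natrX ltr_nat ltn_expl.
Qed.

Lemma gt0_complexE (e : R[i]) : 0 < e -> exists2 x : R, 0 < x & e = x%:C.
Proof.
case: e => a b; rewrite ltcE /= => /andP[/eqP -> a0].
by exists a.
Qed.

Lemma half_small_complex (e : R[i]) : 0 < e -> exists n, 2^-1 ^+ n < e.
Proof.
move=> /gt0_complexE [x x0 ->]; have [n Hn] := half_small_real x0.
exists n; rewrite -ltcR in Hn; apply: le_lt_trans Hn.
by rewrite rmorphXn fmorphV rmorph_nat.
Qed.

Lemma norm_realC x : `|x%:C| = `|x|%:C.
Proof. by rewrite normc_def /= expr0n addr0 sqrtr_sqr. Qed.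

Lemma cvg_realC (u : nat -> R) x : u @ \oo --> x ->
  (fun n => (u n)%:C : C) @ \oo --> (x%:C : C).
Proof.
move=> /cvgrPdist_lt ux; apply/cvgrPdist_lt => _ /gt0_complexE[e e0 ->].
near=> n; rewrite -rmorphB norm_realC ltcR.
by near: n; apply: ux.
Unshelve. all: by end_near. Qed.

Lemma cvg_complex (u v : nat -> R) x y : u @ \oo --> x -> v @ \oo --> y ->
  (fun n => (u n)%:C + 'i * (v n)%:C : C) @ \oo --> (x%:C + 'i * y%:C : C).
Proof.
move=> ux vy; apply: cvgD; first exact: cvg_realC.
by apply: cvgM; [exact: cvg_cst | exact: cvg_realC].
Qed.

Lemma series_complexE (u : nat -> R[i]) (a b : nat -> R) :
  (forall k, u k = (a k)%:C + 'i * (b k)%:C) ->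
  series u = (fun n => (series a n)%:C + 'i * (series b n)%:C).
Proof.
move=> uE; apply/funext => n; rewrite /series /= !rmorph_sum mulr_sumr -big_split.
by apply: eq_bigr => i _; rewrite uE.
Qed.

Lemma normc_ge_Im z : `|complex.Im z|%:C <= `|z|.
Proof. by rewrite normc_def lecR -sqrtr_sqr ler_wsqrtr // lerDr sqr_ge0. Qed.

(** Real and imaginary parts are dominated by the real exponential series of
    the modulus, and the real numbers are complete. *)
Lemma is_cvg_cexp z : cvgn (series (fun k => z ^+ k / k`!%:R : C)).
Proof.
pose w k : R[i] := z ^+ k / k`!%:R.
change (cvgn (series (w : nat -> C))).
have [rho rho0 rhoE] : exists2 rho : R, 0 <= rho & `|z| = rho%:C.
  by exists (Num.sqrt (complex.Re z ^+ 2 + complex.Im z ^+ 2));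
    rewrite ?sqrtr_ge0 ?normc_def.
have nw k : `|w k| = (exp_coeff rho k)%:C.
  rewrite /w normrM normrX rhoE normfV normr_nat /exp_coeff /=.
  by rewrite rmorphM rmorphXn fmorphV rmorph_nat.
have cvg_dom (a : nat -> R) : (forall k, `|a k| <= exp_coeff rho k) ->
    cvgn (series a).
  move=> ha; apply: normed_cvg.
  apply: (@series_le_cvg _ _ (exp_coeff rho)) => //= [n|].
    by rewrite /exp_coeff /= divr_ge0 ?exprn_ge0.
  exact: is_cvg_series_exp_coeff.
have cRe : cvgn (series (fun k => complex.Re (w k))).
  apply: cvg_dom => k; rewrite -lecR -nw; exact: normc_ge_Re.
have cIm : cvgn (series (fun k => complex.Im (w k))).
  apply: cvg_dom => k; rewrite -lecR -nw.
  exact: normc_ge_Im.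
rewrite (@series_complexE w (fun k => complex.Re (w k)) (fun k => complex.Im (w k))).
  by apply/cvg_ex; eexists; apply: cvg_complex; [exact: cRe | exact: cIm].
by move=> k; rewrite -complexiE -complexE.
Qed.

Lemma cvg_cexp z : series (fun k => z ^+ k / k`!%:R : C) @ \oo --> (cexp z : C).
Proof. exact: is_cvg_cexp. Qed.

Lemma exprCi k : ('i : R[i]) ^+ k =
  (if odd k then 0 else (-1) ^+ k./2)%:C +
  'i * (if odd k then (-1) ^+ k.-1./2 else 0)%:C.
Proof.
rewrite -{1}[k]odd_double_half exprD -mul2n exprM sqrCi.
case ok: (odd k) => /=.
  have -> : k.-1./2 = k./2 by rewrite -{1}[k]odd_double_half ok /= doubleK.
  by rewrite expr1 add0r rmorphXn rmorphN rmorph1.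
by rewrite expr0 mul1r mulr0 addr0 rmorphXn rmorphN rmorph1.
Qed.

Definition cis x : R[i] := (cos x)%:C + 'i * (sin x)%:C.

Lemma cexp_cis x : cexp (x%:C * 'i) = cis x.
Proof.
rewrite /cexp (@series_complexE _ (cos_coeff x) (sin_coeff x)).
  apply: cvg_lim; first exact: norm_hausdorff.
  rewrite /cis cos.unlock sin.unlock.
  by apply: cvg_complex; [exact: is_cvg_series_cos_coeff|
    exact: is_cvg_series_sin_coeff].
move=> k; rewrite exprMn exprCi /cos_coeff /sin_coeff /=.
have push (a : R) : (a * x ^+ k / k`!%:R)%:C = a%:C * x%:C ^+ k / k`!%:R.
  by rewrite !rmorphM fmorphV rmorph_nat rmorphXn.
rewrite -!exprnP !push; case: (odd k) => /=.
  by rewrite mul0r mul1r rmorph0; ring.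
by rewrite mul0r mul1r rmorph0; ring.
Qed.

End Complex.

(** * The numbers A and the Bernoulli numbers as coefficients *)
Section Identification.
Local Open Scope classical_set_scope.
Variable K : numFieldType.
Hypothesis half_small : forall e : K, 0 < e -> exists n, 2^-1 ^+ n < e.

Let seriesE (u : nat -> K) n : series u n = \sum_(0 <= i < n) u i.
Proof. by []. Qed.

(** A punctured neighbourhood is enough, and it is all that is known for the
    Bernoulli numbers. *)
Lemma egf_coef (a : nat -> K) (f : fps K) (s : K -> K) :
  (\forall z \near (0 : K)^', egf_sum a z (s z)) ->
  (\forall z \near (0 : K)^', sums_to f z (s z)) ->
  forall k, a k = k`!%:R * f k.
Proof.
move=> Ha Hf k.
have <- := @fps_eq_near K (Fps (fun k => a k / k`!%:R)) f s Ha Hf.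
by rewrite /= mulrC divfK // factr_neq0.
Qed.

Lemma egf_of_fps (f : fps K) z s :
  sums_to f z s -> egf_sum (fun k => k`!%:R * f k) z s.
Proof.
rewrite /egf_sum /sums_to; apply: cvg_trans; apply: near_eq_cvg.
near=> n; rewrite /series /=; apply: eq_bigr => i _.
by rewrite [_ * f i]mulrC mulfK // factr_neq0.
Unshelve. all: by end_near. Qed.

Lemma fexp1_le1 k : `|(fexp 1 : fps K) k| <= 1.
Proof.
rewrite /= expr1n div1r normfV normr_nat invf_le1 ?ltr0n ?fact_gt0 //.
by rewrite ler1n fact_gt0.
Qed.

Hypothesis cexpP : forall z : K, sums_to (fexp 1) z (cexp z).

Lemma sums_toZ c (f : fps K) z s :
  sums_to f z s -> sums_to (fpsC c * f) z (c * s).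
Proof.
move=> fs; have : (fun n => c * series (fun k => f k * z ^+ k) n) @ \oo -->
    (c * s : K) by apply: cvgM; [exact: cvg_cst | exact: fs].
apply: cvg_trans; apply: near_eq_cvg; near=> n.
rewrite !seriesE mulr_sumr; apply: eq_bigr => i _.
by rewrite fpsE_C mulrA.
Unshelve. all: by end_near. Qed.

Lemma sums_to1 (z : K) : sums_to 1 z 1.
Proof.
apply: cvg_near_cst; exists 1%N => // -[//|n] _.
rewrite seriesE big_nat_recl // fpsE1 expr0 mulr1 big1 ?addr0 // => i _.
by rewrite fpsE1 mul0r.
Qed.

(** The expansion exists because [1 / (t exp z - 1)] is the sum of the formal
    inverse, so the chosen sequence does have the defining property, and
    uniqueness of expansions identifies it. *)
Lemma A_fps (t : K) : t != 1 ->
  forall k, A t k = k`!%:R * finv (fpsC t * fexp 1 - 1) k.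
Proof.
move=> t1; set f := fpsC t * fexp 1 - 1.
have f0 : f 0%N != 0.
  by rewrite fpsEB fpsE_C fexp_coef0 fpsE1 mulr1 subr_eq0.
have fC k : `|f k| <= `|t| + 1.
  rewrite fpsEB fpsE_C; apply: le_trans (ler_normB _ _) _.
  apply: lerD; last by rewrite fpsE1; case: eqP => _; rewrite ?normr1 ?normr0.
  by rewrite normrM ler_piMr // fexp1_le1.
have fs z : sums_to f z (t * cexp z - 1).
  by apply: sums_toB (sums_to1 z); apply: sums_toZ; exact: cexpP.
have [r r0 Hr] := inverse_sums_to half_small (mul_finv f0) f0 fC.
have near_inv : \forall z \near (0 : K),
    sums_to (finv f) z (t * cexp z - 1)^-1.
  near=> z; apply: Hr (fs z); near: z.
  exact: (@nbhs0_lt K K r r0).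
apply: (@egf_coef _ _ (fun z => (t * cexp z - 1)^-1)); last exact: nbhs_dnbhs.
apply: nbhs_dnbhs; rewrite /A.
apply: (@getPex _ [set a : nat -> K |
  \forall z \near (0 : K), egf_sum a z (t * cexp z - 1)^-1]).
exists (fun k => k`!%:R * finv f k) => /=.
by apply: filterS near_inv => z; exact: egf_of_fps.
Unshelve. all: by end_near. Qed.

End Identification.

Section Instances.
Local Open Scope classical_set_scope.

Lemma bernoulli_fps (R : realType) k :
  bernoulli R k = k`!%:R * finv (fshift (fexp 1)) k.
Proof.
set f := fshift (fexp 1).
have f0 : f 0%N != 0 by rewrite /= expr1 divr1 oner_neq0.
have fC j : `|f j| <= 1 by exact: fexp1_le1.
have fs (x : R) : x != 0 -> sums_to f x ((expR x - 1) / x).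
  move=> x0.
  have : (fun n => (series (exp_coeff x) n.+1 - 1) / x) @ \oo -->
      ((expR x - 1) / x : R).
    apply: cvgM; last exact: cvg_cst.
    apply: cvgB; last exact: cvg_cst.
    have := @is_cvg_series_exp_coeff R x; rewrite -(cvg_shiftS (series _)).
    exact.
  apply: cvg_trans; apply: near_eq_cvg; near=> n.
  rewrite /series /= big_nat_recl //= /exp_coeff /= expr0 divr1 addrAC subrr add0r.
  rewrite mulr_suml; apply: eq_bigr => i _.
  by rewrite expr1n exprS mulrAC mulrAC; field; rewrite x0 factr_neq0.
have [r r0 Hr] := inverse_sums_to (@half_small_real R) (mul_finv f0) f0 fC.
have near_inv : \forall x \near (0 : R)^', sums_to (finv f) x (x / (expR x - 1)).
  near=> x; rewrite -invf_div; apply: Hr.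
    by near: x; exact: (@dnbhs0_lt R R r r0).
  by apply: fs; near: x; exact: nbhs_dnbhs_neq.
apply: (@egf_coef R _ (finv f) (fun x => x / (expR x - 1))) => //.
rewrite /bernoulli.
apply: (@getPex _ [set B : nat -> R |
  \forall x \near (0 : R)^', egf_sum B x (x / (expR x - 1))]).
exists (fun k => k`!%:R * finv f k) => /=.
by apply: filterS near_inv => z; exact: egf_of_fps.
Unshelve. all: by end_near. Qed.

Lemma A_complex (R : realType) (t : R[i]) : t != 1 ->
  forall k, A t k = k`!%:R * finv (fpsC t * fexp 1 - 1) k.
Proof.
move=> t1; apply: A_fps => //; first exact: half_small_complex.
move=> z; have := @cvg_cexp R z; apply: cvg_trans; apply: near_eq_cvg.
near=> n; rewrite /series /=; apply: eq_bigr => i _.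
by rewrite expr1n mul1r mulrC.
Unshelve. all: by end_near. Qed.

End Instances.

(** * The cosecant series *)
Section MapFps.
Variables (K L : comNzRingType) (h : {rmorphism K -> L}).

Definition fmap (f : fps K) : fps L := Fps (fun k => h (f k)).

Lemma fmapM f g : fmap (f * g) = fmap f * fmap g.
Proof.
apply: fpsP => k; rewrite fpsEM /= rmorph_sum; apply: eq_bigr => i _.
by rewrite rmorphM.
Qed.

Lemma fmap1 : fmap 1 = 1.
Proof. by apply: fpsP => -[|k] /=; rewrite ?rmorph1 ?rmorph0. Qed.

End MapFps.

Section Expansion.
Variable K : comNzRingType.

(** Cutting [g] off after its first [N] even exponents is harmless, because the
    condition on [nu] excludes all degrees beyond [k]. *)
Lemma coef_product (g X Y : fps K) N k : even_fps g -> (k < N)%N ->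
  (g ^+ N * X * Y) k =
  \sum_(j : {ffun 'I_N -> 'I_N}) \sum_(mu < N)
    \sum_(nu < N | ((\sum_(r < N) 2 * j r) + mu + nu == k)%N)
      X mu * Y nu * \prod_(r < N) g (2 * j r)%N.
Proof.
move=> eg kN; pose p : {poly K} := \sum_(j < N) g (2 * j)%N *: 'X^(2 * j).
have pg : agree N p g.
  move=> i iN; rewrite /p coef_sum.
  under eq_bigr do rewrite coefZ coefXn.
  case oi: (odd i).
    rewrite eg // big1 // => j _; rewrite (_ : i == _ = false) ?mulr0 //.
    by apply/negP => /eqP ij; move: oi; rewrite ij oddM.
  have iE : i = (2 * i./2)%N by rewrite mul2n -[LHS]odd_double_half oi.
  have i2 : (i./2 < N)%N by lia.
  rewrite (bigD1 (Ordinal i2)) //= -iE eqxx mulr1 big1 ?addr0 // => j ji.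
  rewrite (_ : i == _ = false) ?mulr0 //; apply/negP => /eqP ij.
  by move/eqP: ji; apply; apply: val_inj => /=; lia.
rewrite -(agreeM (agreeM (agreeX N pg) (agree_ftrunc X)) (agree_ftrunc Y)) //.
have -> : p ^+ N = \prod_(r < N) p by rewrite prodr_const card_ord.
rewrite /p bigA_distr_bigA /= !mulr_suml coef_sum; apply: eq_bigr => j _.
rewrite {1}/ftrunc poly_def mulr_sumr mulr_suml coef_sum; apply: eq_bigr => mu _.
rewrite /ftrunc poly_def mulr_sumr coef_sum [RHS]big_mkcond.
apply: eq_bigr => nu _.
have -> : \prod_(r < N) (g (2 * j r)%N *: 'X^(2 * j r)) =
  (\prod_(r < N) g (2 * j r)%N) *: 'X^(\sum_(r < N) 2 * j r) :> {poly K}.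
  by rewrite scaler_prod prodrXr.
rewrite -!scalerAr -!scalerAl -!exprD !coefZ coefXn eq_sym.
by case: ifP => _; rewrite ?mulr1 ?mulr0 //; ring.
Qed.

End Expansion.

Section Hyperbolic.
Variable K : numFieldType.
Variables B V : fps K.
Hypothesis B_exp : B * (fexp 1 - 1) = fpsX.

(** If [B] is the series of [x / (e^x - 1)], then [B (2x) - 2 B x] is that of
    [- x / sinh x]. *)
Lemma csch_of_bernoulli :
  (fscale 2 B - fpsC 2 * B) * (fexp 1 - fexp (- 1)) = - fpsC 2 * fpsX.
Proof.
have H2 := congr1 (fscale 2) B_exp.
rewrite rmorphM rmorphB rmorph1 /= fexp_scale fscaleX mulr1 in H2.
have e1 : fexp 1 * fexp (- 1) = 1 :> fps K := fexpN 1.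
have e2 : fexp 2 = fexp 1 ^+ 2 :> fps K by rewrite fexp_expn mulr1.
have key : (fscale 2 B - fpsC 2 * B) * (fexp 2 - 1) = - fpsC 2 * fpsX * fexp 1.
  rewrite mulrBl H2 e2.
  have -> : fpsC 2 * B * (fexp 1 ^+ 2 - 1) =
    fpsC 2 * (B * (fexp 1 - 1)) * (fexp 1 + 1) by ring.
  by rewrite B_exp; ring.
have -> : fexp 1 - fexp (- 1) = (fexp 2 - 1) * fexp (- 1) :> fps K.
  by rewrite e2 expr2 mulrBl -mulrA e1 mulr1 mul1r.
by rewrite mulrA key -[_ * fexp 1 * _]mulrA e1 mulr1.
Qed.

Hypothesis V_exp : V * (fexp 1 - fexp (- 1)) = - fpsC 2 * fpsX.

(** In [V_exp] both [x] and the hyperbolic sine are odd, and the latter can be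
    cancelled. *)
Lemma csch_even : even_fps V.
Proof.
move=> k ok; have H := congr1 (fscale (- 1)) V_exp.
rewrite rmorphM rmorphB /= !fexp_scale rmorphM rmorphN /= fscaleX fscaleC in H.
rewrite mulrN1 opprK mulr1 in H.
have E0 : fexp 1 - fexp (- 1) != 0 :> fps K.
  apply: (@fps_neq0 _ _ 1%N); rewrite fpsEB /= !expr1 !divr1 opprK.
  by rewrite (_ : 1 + 1 = 2%:R) ?pnatr_eq0.
have VV : fscale (- 1) V = V.
  apply: (fps_mulI E0); rewrite [RHS]mulrC V_exp.
  have -> : (fexp 1 - fexp (- 1)) * fscale (- 1) V =
    - (fscale (- 1) V * (fexp (- 1) - fexp 1)) by ring.
  by rewrite H rmorphN rmorph1; ring.
have := congr1 (fun f : fps K => f k) VV.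
rewrite fscaleE -signr_odd ok expr1 mulN1r => /eqP.
by rewrite eq_sym -addr_eq0 -mulr2n mulrn_eq0 => /eqP.
Qed.

(** Two square roots of [-1] are allowed because the same series, obtained
    with [i], is used with both exponentials [e^(2iz)] and [e^(-2iz)]. *)
Lemma csc_sqr_exp (i s : K) : i ^+ 2 = -1 -> s ^+ 2 = -1 ->
  fscale i V ^+ 2 * (fexp (2 * s) - 1) ^+ 2 =
  - 4%:R * fpsX ^+ 2 * fexp (2 * s).
Proof.
move=> i2 s2.
have H : fscale i V * (fexp i - fexp (- i)) = - fpsC 2 * (fpsC i * fpsX).
  have := congr1 (fscale i) V_exp.
  rewrite rmorphM rmorphB /= !fexp_scale mulrN mulr1 => ->.
  by rewrite rmorphM rmorphN /= fscaleX fscaleC.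
have H2 : fscale i V ^+ 2 * (fexp s - fexp (- s)) ^+ 2 = - 4%:R * fpsX ^+ 2.
  have -> : (fexp s - fexp (- s)) ^+ 2 = (fexp i - fexp (- i)) ^+ 2 :> fps K.
    have /eqP : (s - i) * (s + i) = 0 by rewrite -subr_sqr s2 i2 subrr.
    rewrite mulf_eq0 subr_eq0 addr_eq0 => /orP[] /eqP -> //.
    by rewrite opprK; ring.
  rewrite -exprMn H.
  have Ci2 : fpsC i ^+ 2 = - 1 by rewrite -rmorphXn /= i2 rmorphN rmorph1.
  have -> : (- fpsC 2 * (fpsC i * fpsX)) ^+ 2 =
    fpsC i ^+ 2 * fpsC 2 ^+ 2 * fpsX ^+ 2 by ring.
  by rewrite Ci2 rmorph_nat; ring.
have e1 : fexp s * fexp (- s) = 1 := fexpN s.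
have e2 : fexp (2 * s) = fexp s ^+ 2 by rewrite fexp_expn.
have -> : fexp (2 * s) - 1 = fexp s * (fexp s - fexp (- s)).
  by rewrite mulrBr e1 e2 expr2.
by rewrite exprMn mulrCA H2 -e2 mulrC.
Qed.

End Hyperbolic.

Section CosecantSeries.
Variable R : realType.
Local Notation C := (R[i]).

(** The series of [- z / sin z]. *)
Definition Gseries : fps C :=
  Fps (fun k => if odd k then 0 else (G R k./2)%:C).

Lemma Gseries_even : even_fps Gseries.
Proof. by move=> k /= ->. Qed.

Definition bernoulli_series : fps C :=
  fmap (real_complex R) (finv (fshift (fexp 1))).

Lemma bernoulli_series_exp : bernoulli_series * (fexp 1 - 1) = fpsX.
Proof.
have BS : bernoulli_series * fshift (fexp 1 - 1) = 1.
  have f0 : fshift (fexp (1 : R)) 0%N != 0 by rewrite /= expr1 divr1 oner_neq0.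
  rewrite -[RHS](fmap1 (real_complex R)) -(mul_finv f0) mulrC fmapM.
  congr (_ * _); apply: fpsP => k /=.
  by rewrite !expr1n subr0 !mul1r fmorphV rmorph_nat.
have -> : fexp 1 - 1 = fpsX * fshift (fexp 1 - 1) :> fps C.
  by apply: fpsX_shift; exact: fexp_sub1_coef0.
by rewrite mulrCA BS mulr1.
Qed.

(** [- x / sinh x] at [x = i z]; the factor [(-1) ^ j] in [G] is [i ^ 2j], and
    its odd coefficients vanish because the function is even. *)
Lemma Gseries_bernoulli :
  Gseries = fscale 'i (fscale 2 bernoulli_series - fpsC 2 * bernoulli_series).
Proof.
have Vodd := csch_even (csch_of_bernoulli bernoulli_series_exp).
apply: fpsP => k; rewrite fscaleE [LHS]/=.
case ok: (odd k); first by rewrite Vodd ?mulr0.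
have kE : k = (2 * k./2)%N by rewrite mul2n -[LHS]odd_double_half ok.
rewrite {2 3}kE; set j := k./2.
rewrite fpsEB fpsE_C fscaleE -mulrBl.
rewrite exprM sqrCi /G bernoulli_fps.
set b := finv _ _; have -> : bernoulli_series (2 * j)%N = b%:C by [].
have f0 := factr_neq0 R (2 * j).
have -> : (-1) ^+ j * 2 * ((2 : R) ^ (2 * j%:Z - 1) - 1) * ((2 * j)`!%:R * b) /
  (2 * j)`!%:R = (-1) ^+ j * ((2 ^+ (2 * j) - 2) * b).
  rewrite (_ : (2 : R) ^ (2 * j%:Z - 1) = 2 ^+ (2 * j) / 2).
    by field; rewrite f0.
  by rewrite expfzDr ?pnatr_eq0 // exprN1 exprnP PoszM.
by rewrite !rmorphM rmorphB !rmorphXn !rmorphN !rmorph1 !rmorph_nat.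
Qed.

Lemma Gseries_sqr_exp (s : C) : s ^+ 2 = -1 ->
  Gseries ^+ 2 * (fexp (2 * s) - 1) ^+ 2 = - 4%:R * fpsX ^+ 2 * fexp (2 * s).
Proof.
move=> s2; rewrite Gseries_bernoulli; apply: csc_sqr_exp s2; last exact: sqrCi.
exact: csch_of_bernoulli bernoulli_series_exp.
Qed.

End CosecantSeries.

(** * Trigonometric evaluation *)
Section Cis.
Variable R : realType.
Implicit Types x y : R.

Lemma cisD x y : cis (x + y) = cis x * cis y.
Proof.
rewrite /cis cosD sinD rmorphB rmorphD !rmorphM.
set a := (cos x)%:C; set b := (sin x)%:C; set c := (cos y)%:C; set e := (sin y)%:C.
rewrite [RHS](_ : _ = a * c + 'i ^+ 2 * (b * e) + 'i * (b * c + a * e));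
  last by ring.
by rewrite sqrCi mulN1r.
Qed.

Lemma cis0 : cis 0 = 1 :> R[i].
Proof. by rewrite /cis cos0 sin0 rmorph0 mulr0 addr0 rmorph1. Qed.

Lemma cisX x n : cis x ^+ n = cis (n%:R * x).
Proof.
elim: n => [|n IH]; first by rewrite mul0r cis0.
by rewrite exprS IH -cisD -[n.+1%:R]nat1r mulrDl mul1r.
Qed.

Lemma cis_mulN x : cis x * cis (- x) = 1.
Proof. by rewrite -cisD subrr cis0. Qed.

Lemma cis_neq0 x : cis x != 0.
Proof.
by apply/eqP => H; move/eqP: (cis_mulN x); rewrite H mul0r eq_sym oner_eq0.
Qed.

Lemma cisN x : cis (- x) = (cis x)^-1.
Proof.
by apply: (mulfI (cis_neq0 x)); rewrite cis_mulN mulfV ?cis_neq0.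
Qed.

Lemma cis_sub x : cis x - cis (- x) = 2 * 'i * (sin x)%:C.
Proof. by rewrite /cis cosN sinN rmorphN /=; ring. Qed.

Lemma cis2_sub1 x : cis (2 * x) - 1 = cis x * (2 * 'i * (sin x)%:C).
Proof. by rewrite -cis_sub mulrBr cis_mulN -cisD mulr2n mulrDl mul1r. Qed.

Lemma cis2pi : cis (2 * pi) = 1 :> R[i].
Proof. by rewrite mulr_natl /cis cos2pi sin2pi rmorph0 mulr0 addr0 rmorph1. Qed.

Lemma cis_int (k : int) : cis (2 * pi * k%:~R) = 1 :> R[i].
Proof.
have cn (n : nat) : cis (2 * pi * n%:R) = 1 :> R[i].
  by rewrite mulrC -cisX cis2pi expr1n.
case: k => n; first exact: cn.
by rewrite NegzE rmorphN /= mulrN cisN cn invr1.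
Qed.

Lemma two_i_neq0 : 2 * 'i != 0 :> R[i].
Proof. by rewrite mulf_neq0 ?pnatr_eq0 // neq0Ci. Qed.

(** After subtraction of the integer part one is left with
    [sin (pi f) = 0] for some [0 <= f < 1]. *)
Lemma cis_eq1 y : cis (2 * pi * y) = 1 -> exists k : int, y = k%:~R.
Proof.
move=> y1; exists (Num.floor y); apply/eqP; rewrite -subr_eq0.
set f := y - _.
have f0 : 0 <= f by rewrite subr_ge0 ge_floor.
have f1 : f < 1 by rewrite ltrBlDr addrC -[1]/(1%:~R) -rmorphD floorD1_gt.
have : cis (2 * (pi * f)) - 1 = 0.
  by rewrite /f mulrBr mulrBr !mulrA cisD y1 cisN cis_int invr1 mulr1 subrr.
rewrite cis2_sub1 => /eqP; rewrite mulf_eq0 (negPf (cis_neq0 _)) /=.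
rewrite mulf_eq0 (negPf two_i_neq0) /= => /eqP/complexI/eqP sf.
apply: contraTT isT => fn0; move: sf; rewrite gt_eqF // sin_gt0_pi //.
have fpos : 0 < f by rewrite lt_def fn0.
by rewrite mulr_gt0 ?pi_gt0 //= gtr_pMr ?pi_gt0.
Qed.

Lemma kappa_cis x : sin x != 0 -> kappa (cis (2 * x)) = (csc x ^+ 2)%:C.
Proof.
move=> sx; rewrite /kappa cis2_sub1 -cisX /csc.
have sC : (sin x)%:C != 0 by rewrite fmorph_eq0.
have c0 := cis_neq0 x.
rewrite exprVn fmorphV rmorphXn.
rewrite [X in _ / X](_ : _ = 'i ^+ 2 * (4 * cis x ^+ 2 * (sin x)%:C ^+ 2));
  last by ring.
by rewrite sqrCi; field; rewrite sC c0.
Qed.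

End Cis.

(** * The sum formula *)

(** The sign [(-1) ^ (mu + nu)] in front of the primed term amounts to
    replacing [i] by [- i]. *)
Lemma two_sided_term (K : fieldType) (i t t' a a' M D fM fN G0 : K) (mu nu : nat) :
  i ^+ (mu + nu) * 2 ^+ (mu + nu) * (M ^+ mu / fM) * (D ^+ nu.+1 / fN)
    * (t * a + (- 1) ^+ (mu + nu) * t' * a') * G0
  = t * ((M * (2 * i)) ^+ mu / fM * (D * ((D * (2 * i)) ^+ nu / fN * a)) * G0)
    + t' * ((M * (2 * - i)) ^+ mu / fM *
            (D * ((D * (2 * - i)) ^+ nu / fN * a')) * G0).
Proof.
rewrite !mulrN !(exprNn (_ * (_ * _))) !exprMn exprS !exprD.
by move: (fM^-1) (fN^-1) => x y; ring.
Qed.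

Lemma triple_sum_linear (K : pzRingType) (I J L : finType)
    (P : I -> J -> pred L) (H X Y : I -> J -> L -> K) (t u : K) :
  (forall i j l, H i j l = t * X i j l + u * Y i j l) ->
  \sum_i \sum_j \sum_(l | P i j l) H i j l =
  t * (\sum_i \sum_j \sum_(l | P i j l) X i j l) +
  u * (\sum_i \sum_j \sum_(l | P i j l) Y i j l).
Proof.
move=> HE; rewrite !mulr_sumr -big_split; apply: eq_bigr => i _ /=.
rewrite !mulr_sumr -big_split; apply: eq_bigr => j _ /=.
by rewrite !mulr_sumr -big_split; apply: eq_bigr => l _ /=.
Qed.

Section Side.
Variable R : realType.
Local Notation C := (R[i]).
Variables (m n d : nat) (s T : C) (w : 'I_d -> C).
Hypotheses (m0 : (0 < m)%N) (md : (m < d)%N) (s2 : s ^+ 2 = -1).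
Hypotheses (T0 : T != 0) (T1 : T != 1).
Hypotheses (wT : forall j, w j ^+ d = T).
Hypotheses (w_sum : forall p, (0 < p < d)%N -> \sum_j w j ^+ p = 0).

(** One half of the right-hand side: [s] is [i] for the unprimed terms and
    [- i] for the primed ones, where [T] and all [w j] are replaced by their
    inverses. *)
Lemma one_sided_sum :
  \sum_(j : {ffun 'I_(2 * n.+1) -> 'I_(2 * n.+1)}) \sum_(mu < 2 * n.+1)
    \sum_(nu < 2 * n.+1 |
      ((\sum_(r < 2 * n.+1) 2 * j r) + mu + nu == (2 * n).+1)%N)
      (m%:R * (2 * s)) ^+ mu / mu`!%:R *
      (d%:R * ((d%:R * (2 * s)) ^+ nu / nu`!%:R * A T^-1 nu)) *
      (F R (fun r => j r : nat))%:C
  = - \sum_j w j ^+ m * kappa (w j) ^+ n.+1 / (2 * s).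
Proof.
have s0 : s != 0.
  by apply/eqP => H; move/eqP: s2; rewrite H expr0n eq_sym oppr_eq0 oner_eq0.
have c0 : 2 * s != 0 by rewrite mulf_neq0 // pnatr_eq0.
have Ti1 : T^-1 != 1 by rewrite invr_eq1.
pose q := finv (fpsC T^-1 * fexp 1 - 1).
have HQ : (fpsC T^-1 * fexp (2 * s) ^+ d - 1) * fscale (d%:R * (2 * s)) q = 1.
  rewrite fexp_expn.
  transitivity (fscale (d%:R * (2 * s)) ((fpsC T^-1 * fexp 1 - 1) * q)).
    by rewrite rmorphM rmorphB rmorphM rmorph1 /= fscaleC fexp_scale mulr1.
  rewrite mul_finv ?rmorph1 //.
  by rewrite fpsEB fpsE_C fexp_coef0 fpsE1 mulr1 subr_eq0.
have cE : even_fps (Gseries R ^+ 2) by apply: even_fpsX; exact: Gseries_even.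
rewrite -(coef_root_sum c0 cE (Gseries_sqr_exp s2) m0 md T0 T1 wT w_sum n HQ).
set Q := fscale _ q; rewrite -exprM.
have -> : Gseries R ^+ (2 * n.+1) * (d%:R * fexp (2 * s) ^+ m * Q) =
  Gseries R ^+ (2 * n.+1) * fexp (2 * s) ^+ m * (d%:R * Q) by ring.
rewrite coef_product; [|exact: Gseries_even|by rewrite mulnS].
apply: eq_bigr => j _; apply: eq_bigr => mu _; apply: eq_bigr => nu _.
congr (_ * _ * _).
- by rewrite fexp_expn.
- rewrite -(rmorph_nat (@fpsC C) d) fpsE_C fscaleE A_complex //.
  by congr (_ * _); rewrite [LHS]mulrA divfK ?factr_neq0.
- rewrite /F rmorph_prod; apply: eq_bigr => r _.
  by move: (nat_of_ord (j r)) => a /=; rewrite mul2n odd_double doubleK.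
Qed.

End Side.

(* Every nonnegative solution of 2 j_1 + ... + 2 j_(2n) + mu + nu = 2n - 1 has
   all its entries < 2n, so the summation indices are taken in 'I_(2 * n). *)
Theorem theorem1p5 (R : realType) (m n d : nat) (b : R)
  (hm : (0 < m)%N) (hn : (0 < n)%N) (hd : (0 < d)%N) (hmd : (m < d)%N)
  (hb : forall k : int, b <> k%:~R / d%:R) :
  let t1 : R[i] := cexp (- (2 * pi * m%:R * b)%:C * 'i) in
  let t2 : R[i] := cexp (- (2 * pi * d%:R * b)%:C * 'i) in
  let t1' : R[i] := cexp ((2 * pi * m%:R * b)%:C * 'i) in
  let t2' : R[i] := cexp ((2 * pi * d%:R * b)%:C * 'i) in
  (\sum_(1 <= j < d)
     sin (2 * pi * m%:R * j%:R / d%:R)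
     * csc (pi * j%:R / d%:R + pi * b) ^+ (2 * n))%:C
  = - \sum_(j : {ffun 'I_(2 * n) -> 'I_(2 * n)})
      \sum_(mu < 2 * n)
      \sum_(nu < 2 * n | ((\sum_(r < 2 * n) 2 * j r) + mu + nu == 2 * n - 1)%N)
        'i ^+ (mu + nu) * 2 ^+ (mu + nu)
        * (m%:R ^+ mu / mu`!%:R) * (d%:R ^+ nu.+1 / nu`!%:R)
        * (t1 * A t2 nu + (- 1) ^+ (mu + nu) * t1' * A t2' nu)
        * (F R (fun r => j r : nat))%:C.
Proof.
move=> t1 t2 t1' t2'; case: n hn => // n' _.
pose th (j : 'I_d) : R := pi * j%:R / d%:R + pi * b.
have d0 : d%:R != 0 :> R by rewrite pnatr_eq0 -lt0n.
have et2' : t2' = cis (2 * pi * (d%:R * b)) by rewrite /t2' cexp_cis mulrA.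
have et1' : t1' = cis (2 * pi * m%:R * b) by rewrite /t1' cexp_cis.
have et2 : t2 = t2'^-1.
  by rewrite et2' -cisN -cexp_cis /t2 rmorphN !mulrA.
have et1 : t1 = t1'^-1.
  by rewrite et1' -cisN -cexp_cis /t1 rmorphN.
clearbody t1 t2 t1' t2'; rewrite {}et1 {}et2; clear t1 t2.
have T0 : t2' != 0 by rewrite et2' cis_neq0.
have T1 : t2' != 1.
  rewrite et2'; apply/eqP => /cis_eq1 [k kE]; apply: (hb k).
  by rewrite -kE mulrAC mulfV // mul1r.
pose w (j : 'I_d) : R[i] := cis (2 * th j).
have wE j : w j = cis (2 * th j) by [].
clearbody w.
have wT j : w j ^+ d = t2'.
  rewrite wE cisX et2'.
  have -> : d%:R * (2 * th j) = 2 * pi * (j%:Z)%:~R + 2 * pi * (d%:R * b).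
    by rewrite /th -pmulrn; field.
  by rewrite cisD cis_int mul1r.
(* A geometric sum with ratio [e^(2 i pi p / d)], a root of unity different
   from [1]. *)
have w_sum p : (0 < p < d)%N -> \sum_j w j ^+ p = 0.
  move=> /andP[p0 pd]; pose z : R[i] := cis (2 * pi * (p%:R / d%:R)).
  have z1 : z != 1.
    apply/eqP => /cis_eq1 [k kE].
    have : (p%:Z)%:~R = (k * d%:Z)%:~R :> R.
      by rewrite intrM -kE -!pmulrn divfK.
    move/intr_inj => pk; have k0 : (0 < k)%R by nia.
    by nia.
  have zd : z ^+ d = 1.
    rewrite /z cisX; have -> : d%:R * (2 * pi * (p%:R / d%:R)) =
      2 * pi * (p%:Z)%:~R :> R by rewrite -pmulrn; field.
    exact: cis_int.
  have -> : \sum_j w j ^+ p = cis (p%:R * (2 * pi * b)) * \sum_(j < d) z ^+ j.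
    rewrite mulr_sumr; apply: eq_bigr => j _.
    rewrite wE /z !cisX -cisD; congr cis; rewrite /th; field.
    by [].
  apply/eqP; rewrite mulf_eq0; apply/orP; right.
  have := subrX1 z d; rewrite zd subrr => /esym/eqP.
  by rewrite mulf_eq0 subr_eq0 (negPf z1).
have wi j : (w j)^-1 = cis (2 * - th j) by rewrite mulrN cisN wE.
have wiT j : (w j)^-1 ^+ d = t2'^-1 by rewrite exprVn wT.
have wi_sum p : (0 < p < d)%N -> \sum_j (w j)^-1 ^+ p = 0.
  move=> pd; have := w_sum (d - p)%N; rewrite (_ : (_ < _ < _)%N); last by lia.
  move=> /(_ isT) H; apply: (mulfI T0); rewrite mulr0 -[RHS]H mulr_sumr.
  apply: eq_bigr => j _; rewrite -(wT j) exprVn.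
  have wn : w j != 0 by rewrite wE cis_neq0.
  by rewrite -expfB_cond // (negPf wn); lia.
have w1 j : w j != 1 by exact: root_neq1 T1 wT j.
have sin_th j : sin (th j) != 0.
  apply: contraNneq (w1 j) => H.
  by rewrite -subr_eq0 wE cis2_sub1 H rmorph0 !mulr0.
have kw j : kappa (w j) = (csc (th j) ^+ 2)%:C by rewrite wE kappa_cis.
have kwi j : kappa (w j)^-1 = (csc (th j) ^+ 2)%:C.
  by rewrite wi kappa_cis ?sinN ?oppr_eq0 // /csc sinN invrN sqrrN.
have Ti0 : t2'^-1 != 0 by rewrite invr_eq0.
have Ti1 : t2'^-1 != 1 by rewrite invr_eq1.
have i2 : ('i : R[i]) ^+ 2 = -1 by exact: sqrCi.
have i2N : (- 'i : R[i]) ^+ 2 = -1 by rewrite sqrrN sqrCi.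
have S1 := one_sided_sum n' hm hmd i2 T0 T1 wT w_sum.
have S2 := one_sided_sum n' hm hmd i2N Ti0 Ti1 wiT wi_sum.
rewrite invrK in S2.
have -> : (2 * n'.+1 - 1 = (2 * n').+1)%N by lia.
transitivity (- (t1'^-1 * (- \sum_j w j ^+ m * kappa (w j) ^+ n'.+1 / (2 * 'i)) +
   t1' * (- \sum_j (w j)^-1 ^+ m * kappa (w j)^-1 ^+ n'.+1 / (2 * - 'i)))); last first.
  congr (- _); rewrite -S1 -S2; symmetry; apply: triple_sum_linear => j mu nu.
  exact: two_sided_term.
rewrite !mulrN -opprD opprK !mulr_sumr -big_split /=.
pose f (j : nat) := sin (2 * pi * m%:R * j%:R / d%:R)
     * csc (pi * j%:R / d%:R + pi * b) ^+ (2 * n'.+1).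
(* The term with [j = 0] vanishes because of the sine. *)
have -> : \sum_(1 <= j < d) f j = \sum_(j < d) f j.
  rewrite -(big_mkord xpredT f) [RHS]big_ltn // /f.
  by rewrite mulr0 mul0r sin0 mul0r add0r.
rewrite rmorph_sum; apply: eq_bigr => j _; rewrite kw kwi.
pose phi : R := 2 * pi * m%:R * j%:R / d%:R.
have wm : w j ^+ m = t1' * cis phi.
  rewrite wE cisX et1' -cisD; congr cis; rewrite /th /phi; field.
  by [].
have t0 : t1' != 0 by rewrite et1' cis_neq0.
transitivity ((sin phi)%:C * ((csc (th j) ^+ 2)%:C) ^+ n'.+1).
  by rewrite /f -/phi -/(th j) rmorphM exprM rmorphXn.
rewrite exprVn wm; have := cis_sub phi; rewrite cisN.
have i0 : 'i != 0 :> R[i] by exact: neq0Ci.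
have p0 := cis_neq0 phi.
move: (_ ^+ n'.+1) (cis phi) p0 (sin phi)%:C ('i : R[i]) i0 => k z z0 S i i0 zS.
have -> : S = (z - z^-1) / (2 * i).
  by rewrite zS; field; rewrite i0.
by field; rewrite t0 i0 z0.
Qed.
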